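(* Let $\mathfrak{X}=(c_0,p)$ be the Banach space constructed from the data $(\vert\vert\vert\cdot\vert\vert\vert, Y, T)$ as described in the context. Then the bidual $\mathfrak{X}^{**}$ is strictly convex; hence $\mathfrak{X}^*$ is smooth.
   Context: All Banach spaces are real; $\mathbb{N}=\{1,2,\dots\}$; operators are bounded and linear. $B_X$, $S_X$ are the closed unit ball and unit sphere of $X$; $X^*$ is the dual with the dual norm. $\operatorname{NA}(X,\mathbb{R})$ is the set of $f\in X^*$ for which there is $x\in S_X$ with $|f(x)|=\|f\|$. A norm is smooth if it is Gâteaux differentiable at every non-zero point (equivalently, every non-zero point has a unique norm-one supporting functional). A linear subspace $Y$ of a Banach space $V$ is an operator range if there are an infinite-dimensional Banach space $E$ and a bounded injective operator $E\to V$ with range $Y$; $Y$ carries the norm inherited from $V$, and $S_Y$ is its unit sphere for that norm. Construction of $\mathfrak{X}$. (1) Let $X=c_0$ be endowed with an equivalent smooth norm $\vert\vert\vert\cdot\vert\vert\vert$ such that $\operatorname{NA}((X,\vert\vert\vert\cdot\vert\vert\vert),\mathbb{R})=\operatorname{NA}(c_0,\mathbb{R})$, where $c_0$ has its usual supremum norm. The dual norm on $X^*$ is also written $\vert\vert\vert\cdot\vert\vert\vert$. Let $Y$ be a separable operator range, norm dense in $(X,\vert\vert\vert\cdot\vert\vert\vert)^*$, with $\operatorname{NA}((X,\vert\vert\vert\cdot\vert\vert\vert),\mathbb{R})\cap Y=\{0\}$. (2) Let $T:\ell_1(\mathbb{N}\times\mathbb{N})\to Y\subset (X,\vert\vert\vert\cdot\vert\vert\vert)^*$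 be a norm-one injective operator such that, for every $m\in\mathbb{N}$, the set $\{T(e_{n,m})/\vert\vert\vert T(e_{n,m})\vert\vert\vert : n\in\mathbb{N}\}$ is dense in $S_Y$, where $(e_{n,m})$ is the canonical basis of $\ell_1(\mathbb{N}\times\mathbb{N})$. Put $v^*_{n,m}=T(e_{n,m})$. (Such $\vert\vert\vert\cdot\vert\vert\vert$, $Y$, $T$ exist; they are fixed.) (3) For $m\in\mathbb{N}$, let $\Phi_m(n)=\frac{1}{2^m}\frac{1}{2^n}\vert\vert\vert v^*_{n,m}\vert\vert\vert$ $(n\in\mathbb{N})$, let $S_{\Phi_m}:\ell_2\to\ell_1$ be given by $[S_{\Phi_m}(a)](n)=\Phi_m(n)a(n)$, and let $|\cdot|_m$ be the equivalent norm on $\ell_1$ whose closed unit ball is $B_{\ell_1}+S_{\Phi_m}(B_{\ell_2})$. (4) For $m\in\mathbb{N}$, define $R_m:X\to \ell_1$ by $[R_m(x)](n)=\frac{m}{2^m}\frac{1}{2^n}v^*_{n,m}(x)$ for $n\in\mathbb{N}$, $x\in X$. (5) Define the equivalent norm $p$ on $X=c_0$ by $p(x)=\vert\vert\vert x\vert\vert\vert+\sum_{m=1}^\infty |R_m(x)|_m$ for $x\in X$, and set $\mathfrak{X}=(X,p)$. *)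

(* Defs.v *)
From HB Require Import structures.
From mathcomp Require Import all_boot all_order all_algebra.
From mathcomp Require Import all_classical all_reals all_analysis.
From mathcomp Require Import ring lra.

Set Implicit Arguments.
Unset Strict Implicit.
Unset Printing Implicit Defensive.

Import Order.TTheory GRing.Theory Num.Theory.
Import numFieldNormedType.Exports.
Local Open Scope classical_set_scope.
Local Open Scope ring_scope.

Section operator.
Variables (R : realType) (V W : normedModType R).

(* The bounded linear operators V -> W, as a normed space for the operator norm. *)
Definition bounded_operator : {pred V -> W} :=
  [pred f : V -> W | `[< linear f /\ continuous f >]].

Record operator := Operator {
  op_fun :> V -> W;
  _ : op_fun \in bounded_operator }.

HB.instance Definition _ := [isSub for op_fun].
HB.instance Definition _ := [Choice of operator by <:].

Lemma bounded_operator_submod : submod_closed bounded_operator.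
Proof.
split=> [|a f g /asboolP[lf cf] /asboolP[lg cg]]; apply/asboolP; split.
- by move=> b x y /=; rewrite scaler0 addr0.
- exact: cst_continuous.
- move=> b x y; rewrite !fctE lf lg !scalerDr -!addrA; congr +%R.
    by rewrite !scalerA mulrC.
  by rewrite addrCA.
- move=> x; apply: continuousD; last exact: cg.
  by apply: continuousZl_tmp; exact: cf.
Qed.

HB.instance Definition _ :=
  GRing.isSubmodClosed.Build R (V -> W) bounded_operator bounded_operator_submod.
HB.instance Definition _ := [SubChoice_isSubLmodule of operator by <:].

Lemma op_linear (f : operator) : linear f.
Proof. by case: f => f /= /asboolP[]. Qed.

HB.instance Definition _ (f : operator) :=
  GRing.isLinear.Build R V W *:%R (op_fun f) (op_linear f).

Lemma op_morphD (f : operator) x y : f (x + y) = f x + f y.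
Proof. exact: linearD. Qed.

Lemma op_morphZ (f : operator) a x : f (a *: x) = a *: f x.
Proof. exact: linearZ. Qed.

Lemma op_continuous (f : operator) : continuous f.
Proof. by case: f => f /= /asboolP[]. Qed.

Definition opnorm (f : V -> W) : R :=
  sup [set `|f x| | x in [set x : V | `|x| <= 1]].

Lemma opnorm_has_sup (f : operator) :
  has_sup [set `|f x| | x in [set x : V | `|x| <= 1]].
Proof.
split; first by exists `|f 0|, 0 => //=; rewrite normr0.
have /linear_bounded_continuous := @op_continuous f.
move/bounded_funP => /(_ 1)[M fM].
by exists M => _ [x /= x1 <-]; exact: fM.
Qed.

Lemma opnorm_ge (f : operator) x : `|f x| <= opnorm f * `|x|.
Proof.
have [->|x0] := eqVneq x 0; first by rewrite linear0 !normr0 mulr0.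
have nx0 : 0 < `|x| by rewrite normr_gt0.
rewrite -ler_pdivrMr// mulrC -[_^-1]ger0_norm ?invr_ge0// -normrZ -linearZ/=.
apply: ub_le_sup; first by case: (opnorm_has_sup f).
by exists (`|x|^-1 *: x) => //=; rewrite normrZ ger0_norm ?invr_ge0// mulVf ?gt_eqF.
Qed.

Lemma opnorm_le (f : operator) M : (forall x, `|x| <= 1 -> `|f x| <= M) ->
  opnorm f <= M.
Proof.
move=> fM; apply: ge_sup; first by case: (opnorm_has_sup f).
by move=> _ [x /= /fM ? <-].
Qed.

Lemma opnorm_ge0 (f : operator) : 0 <= opnorm f.
Proof.
apply: ub_le_sup; first by case: (opnorm_has_sup f).
by exists 0; rewrite /= ?normr0// linear0 normr0.
Qed.

Lemma opnormD (f g : operator) : opnorm (f + g : operator) <= opnorm f + opnorm g.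
Proof.
apply: opnorm_le => x x1; apply: (le_trans (ler_normD _ _)).
by apply: lerD; apply: (le_trans (opnorm_ge _ _)); rewrite ler_piMr ?opnorm_ge0.
Qed.

Lemma opnormZ (a : R) (f : operator) : opnorm (a *: f : operator) = `|a| * opnorm f.
Proof.
have le b (g : operator) : opnorm (b *: g : operator) <= `|b| * opnorm g.
  apply: opnorm_le => x x1; rewrite [_ x]/(b *: g x) normrZ ler_wpM2l//.
  by apply: (le_trans (opnorm_ge _ _)); rewrite ler_piMr ?opnorm_ge0.
apply/eqP; rewrite eq_le le andTb.
have [->|a0] := eqVneq a 0; first by rewrite normr0 mul0r opnorm_ge0.
rewrite -ler_pdivlMl ?normr_gt0// -normfV.
by rewrite -{1}[f](scalerK a0) le.
Qed.

Lemma opnorm_eq0 (f : operator) : opnorm f = 0 -> f = 0.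
Proof.
move=> f0; apply/val_inj/funext => x /=; apply/eqP.
by have := opnorm_ge f x; rewrite f0 mul0r normr_le0.
Qed.

HB.instance Definition _ :=
  Lmodule_isNormed.Build R operator opnormD opnormZ opnorm_eq0.

Lemma op_normE (f : operator) : `|f| = opnorm f.
Proof. by []. Qed.

End operator.

Arguments bounded_operator {R} V W.

Definition dual (R : realType) (V : normedModType R) := operator V R.

Section banach.
Variable R : realType.
Implicit Type V : normedModType R.

Definition NA V : set (dual V) :=
  [set f : dual V | exists2 x : V, `|x| = 1 & `|f x| = `|f|].

(* Gateaux differentiability of the norm at every nonzero point: the directional
   derivatives at x exist and form a bounded linear functional. *)
Definition smooth V := forall x : V, x != 0 ->
  exists g : dual V, forall h : V, is_derive x h (fun y : V => `|y| : R) (g h).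

Definition strictly_convex V := forall x y : V,
  `|x| = 1 -> `|y| = 1 -> x <> y -> `|x + y| < 2.

Definition infinite_dimensional V := forall (n : nat) (e : 'I_n -> V),
  exists x : V, forall c : 'I_n -> R, x <> \sum_i c i *: e i.

Definition operator_range V (Y : set V) :=
  exists (E : completeNormedModType R) (S : operator E V),
    [/\ infinite_dimensional E, injective S & range S = Y].

Definition separable V (Y : set V) :=
  exists D : set V, [/\ countable D, D `<=` Y & Y `<=` closure D].

Definition unit_sphere V (Y : set V) : set V := [set y | Y y /\ `|y| = 1].

End banach.

Arguments NA {R} V _.

Section renorming.
Variables (R : realType) (V : normedModType R).

(* An equivalent norm on V; nonnegativity follows from enorm_lower. *)
Record equiv_norm := EquivNorm {
  enorm :> V -> R;
  enormD : forall x y, enorm (x + y) <= enorm x + enorm y;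
  enormZ : forall a x, enorm (a *: x) = `|a| * enorm x;
  enorm_lower : exists2 c, 0 < c & forall x, c * `|x| <= enorm x;
  enorm_upper : exists C, forall x, enorm x <= C * `|x| }.

Lemma enorm_eq0 (N : equiv_norm) x : enorm N x = 0 -> x = 0.
Proof.
have [c c0 cN] := enorm_lower N => Nx0; apply/eqP.
by have := cN x; rewrite Nx0 pmulr_rle0// normr_le0.
Qed.

(* The same vector space V, with N in place of its original norm. *)
Definition renorm (N : equiv_norm) : Type := V.

HB.instance Definition _ (N : equiv_norm) := GRing.Lmodule.on (renorm N).
HB.instance Definition _ (N : equiv_norm) :=
  Lmodule_isNormed.Build R (renorm N) (enormD N) (enormZ N) (@enorm_eq0 N).

Lemma renorm_normE (N : equiv_norm) (x : renorm N) : `|x| = N x.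
Proof. by []. Qed.

End renorming.

Section c0.
Variable R : realType.

Definition null_sequence : {pred nat -> R} :=
  [pred x : nat -> R | `[< x @ \oo --> (0 : R) >]].

Record c0 := C0 { c0_seq :> nat -> R; _ : c0_seq \in null_sequence }.

HB.instance Definition _ := [isSub for c0_seq].
HB.instance Definition _ := [Choice of c0 by <:].

Lemma null_sequence_submod : submod_closed null_sequence.
Proof.
split=> [|a x y /asboolP cx /asboolP cy]; apply/asboolP; first exact: cvg_cst.
have := cvgD (cvgZl_tmp (k := a) cx) cy; rewrite scaler0 addr0; exact.
Qed.

HB.instance Definition _ :=
  GRing.isSubmodClosed.Build R (nat -> R) null_sequence null_sequence_submod.
HB.instance Definition _ := [SubChoice_isSubLmodule of c0 by <:].

Definition c0_norm (x : c0) : R := sup (range (fun n => `|x n|)).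

Lemma c0_norm_ge (x : c0) n : `|x n| <= c0_norm x.
Proof.
apply: ub_le_sup; last by exists n.
have /asboolP/cvgP/cvg_seq_bounded : c0_seq x \in null_sequence by case: x.
case=> M [_ xM]; exists (M + 1) => _ [k _ <-]; apply: (xM (M + 1)) => //.
by rewrite ltrDl.
Qed.

Lemma c0_norm_le (x : c0) M : (forall n, `|x n| <= M) -> c0_norm x <= M.
Proof. by move=> xM; apply: ge_sup; [exists `|x 0%N|, 0%N|move=> _ [n _ <-]]. Qed.

Lemma c0_normD x y : c0_norm (x + y) <= c0_norm x + c0_norm y.
Proof.
by apply: c0_norm_le => n; apply: (le_trans (ler_normD _ _)); apply: lerD; exact: c0_norm_ge.
Qed.

Lemma c0_normZ (a : R) (x : c0) : c0_norm (a *: x) = `|a| * c0_norm x.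
Proof.
have le b (y : c0) : c0_norm (b *: y) <= `|b| * c0_norm y.
  by apply: c0_norm_le => n; rewrite [_ n]/(b *: y n) normrZ ler_wpM2l// c0_norm_ge.
apply/eqP; rewrite eq_le le andTb.
have [->|a0] := eqVneq a 0.
  by rewrite normr0 mul0r; exact: le_trans (c0_norm_ge _ 0%N).
by rewrite -ler_pdivlMl ?normr_gt0// -normfV -{1}[x](scalerK a0) le.
Qed.

Lemma c0_norm_eq0 (x : c0) : c0_norm x = 0 -> x = 0.
Proof.
move=> x0; apply/val_inj/funext => n /=; apply/eqP.
by have := c0_norm_ge x n; rewrite x0 normr_le0.
Qed.

HB.instance Definition _ :=
  Lmodule_isNormed.Build R c0 c0_normD c0_normZ c0_norm_eq0.

End c0.
Arguments c0 R : clear implicits.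

Section l1.
Variables (R : realType) (I : choiceType).

Definition absolutely_summable : {pred I -> R} :=
  [pred x : I -> R | summable [set: I] (EFin \o x)].

Record l1 := L1 { l1_fun :> I -> R; _ : l1_fun \in absolutely_summable }.

HB.instance Definition _ := [isSub for l1_fun].
HB.instance Definition _ := [Choice of l1 by <:].

Lemma esumZ_le (c : R) (f : I -> \bar R) : 0 <= c -> (forall i, 0 <= f i)%E ->
  (\esum_(i in [set: I]) (c%:E * f i) <= c%:E * \esum_(i in [set: I]) f i)%E.
Proof.
move=> c0 f0; apply: ge_ereal_sup => _ [A Afin <-].
rewrite -ge0_mule_fsumr//; apply: lee_wpmul2l; first by rewrite lee_fin.
by apply: ereal_sup_ubound; exists A.
Qed.

Definition l1_norm (x : I -> R) : R := fine (\esum_(i in [set: I]) `|x i|%:E).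

Lemma absolutely_summable_esum (x : I -> R) : x \in absolutely_summable ->
  (\esum_(i in [set: I]) `|x i|%:E = (l1_norm x)%:E)%E.
Proof.
rewrite inE/= => sx; rewrite fineK// ge0_fin_numE//.
by apply: esum_ge0 => i _; rewrite lee_fin.
Qed.

Lemma l1_esum (x : l1) : (\esum_(i in [set: I]) `|x i|%:E = (l1_norm x)%:E)%E.
Proof. by apply: absolutely_summable_esum; case: x. Qed.

Lemma esum_le_summable (x : I -> R) (M : R) :
  (\esum_(i in [set: I]) `|x i|%:E <= M%:E)%E -> x \in absolutely_summable.
Proof. by move=> xM; rewrite inE /summable; apply: le_lt_trans (ltry M). Qed.

Lemma absolutely_summable_submod : submod_closed absolutely_summable.
Proof.
split=> [|a x y sx sy].
  by apply: (@esum_le_summable _ 0); rewrite esum1// => i _; rewrite normr0.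
apply: (@esum_le_summable _ (`|a| * l1_norm x + l1_norm y)).
rewrite EFinD EFinM -!absolutely_summable_esum//.
apply: le_trans (leeD (esumZ_le (f := fun i => `|x i|%:E) _ _) (le_refl _)) => //.
rewrite -esumD//.
apply: le_esum => i _; rewrite -EFinM -EFinD lee_fin.
by rewrite (le_trans (ler_normD _ _))// normrZ.
Qed.

HB.instance Definition _ :=
  GRing.isSubmodClosed.Build R (I -> R) absolutely_summable absolutely_summable_submod.
HB.instance Definition _ := [SubChoice_isSubLmodule of l1 by <:].

Lemma l1_addE (x y : l1) i : (x + y) i = x i + y i. Proof. by []. Qed.
Lemma l1_oppE (x : l1) i : (- x) i = - x i. Proof. by []. Qed.
Lemma l1_scaleE a (x : l1) i : (a *: x) i = a * x i. Proof. by []. Qed.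

Lemma l1_normD (x y : l1) : l1_norm (x + y : l1) <= l1_norm x + l1_norm y.
Proof.
rewrite -lee_fin EFinD -!l1_esum -esumD//.
by apply: le_esum => i _; rewrite -EFinD lee_fin ler_normD.
Qed.

Lemma l1_norm_ge (x : l1) i : `|x i| <= l1_norm x.
Proof.
rewrite -lee_fin -l1_esum; apply: esum_ge; exists [set i]; first by split.
by rewrite fsbig_set1.
Qed.

Lemma l1_normZ (a : R) (x : l1) : l1_norm (a *: x : l1) = `|a| * l1_norm x.
Proof.
have le b (y : l1) : l1_norm (b *: y : l1) <= `|b| * l1_norm y.
  rewrite -lee_fin EFinM -!l1_esum.
  apply: le_trans (esumZ_le (f := fun i => `|y i|%:E) _ _) => //.
  by apply: le_esum => i _; rewrite -EFinM lee_fin l1_scaleE normrM.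
apply/eqP; rewrite eq_le le andTb.
have [->|a0] := eqVneq a 0.
  by rewrite normr0 mul0r -lee_fin -l1_esum esum_ge0.
by rewrite -ler_pdivlMl ?normr_gt0// -normfV -{1}[x](scalerK a0) le.
Qed.

Lemma l1_norm_eq0 (x : l1) : l1_norm x = 0 -> x = 0.
Proof.
move=> x0; apply/val_inj/funext => n /=; apply/eqP.
by have := l1_norm_ge x n; rewrite x0 normr_le0.
Qed.

HB.instance Definition _ :=
  Lmodule_isNormed.Build R l1 l1_normD l1_normZ l1_norm_eq0.

Lemma l1_unit_esum (i : I) :
  (\esum_(j in [set: I]) `|(j == i)%:R : R|%:E = 1)%E.
Proof.
rewrite (eq_esum (b := fun j => if j \in [set i] then 1 else 0)%E); last first.
  move=> j _; have [->|/eqP ji] := eqVneq j i.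
    by rewrite mem_set// normr1.
  by rewrite memNset// normr0.
by rewrite -esum_mkcond esum_set1.
Qed.

Lemma l1_unit_subproof (i : I) : (fun j => (j == i)%:R : R) \in absolutely_summable.
Proof. by apply: (@esum_le_summable _ 1); rewrite l1_unit_esum. Qed.

Definition l1_unit (i : I) : l1 := L1 (l1_unit_subproof i).

Lemma norm_l1_unit (i : I) : `|l1_unit i| = 1.
Proof. by apply: EFin_inj; rewrite -[X in (X%:E = _)%E]/(l1_norm _) -l1_esum l1_unit_esum. Qed.

End l1.
Arguments l1 R I : clear implicits.

Section gauge.
Variables (R : realType) (V : normedModType R).

(* The Minkowski functional of B; it is the norm with closed unit ball B when B
   is the closed unit ball of some norm, see diag_norm_unit_ball below. *)
Definition gauge (B : set V) (x : V) : R :=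
  inf [set r | 0 < r /\ B (r^-1 *: x)].

Variables (B : set V) (M : R).
Hypotheses (M_gt0 : 0 < M) (ballB : forall x, `|x| <= 1 -> B x)
  (Bbounded : forall x, B x -> `|x| <= M) (Bsym : forall x, B x -> B (- x))
  (Bconvex : forall x y t, B x -> B y -> 0 <= t <= 1 ->
    B (t *: x + (1 - t) *: y)).

Lemma gauge_mem (x : V) r : 0 < r -> `|x| <= r -> B (r^-1 *: x).
Proof.
move=> r0 xr; apply: ballB.
by rewrite normrZ gtr0_norm ?invr_gt0// mulrC ler_pdivrMr// mul1r.
Qed.

Lemma gauge_has_inf (x : V) : has_inf [set r | 0 < r /\ B (r^-1 *: x)].
Proof.
split; last by exists 0 => r [/ltW].
have x1 : 0 < `|x| + 1 by rewrite ltr_wpDl.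
by exists (`|x| + 1); split=> //; apply: gauge_mem => //; rewrite lerDl.
Qed.

Lemma gauge_le (x : V) r : 0 < r -> B (r^-1 *: x) -> gauge B x <= r.
Proof. by move=> r0 Br; apply: ge_inf => //; case: (gauge_has_inf x). Qed.

Lemma gauge_lt (x : V) r : gauge B x < r ->
  exists2 s, s < r & 0 < s /\ B (s^-1 *: x).
Proof.
rewrite -subr_gt0 => /(@inf_adherent _ _ _)/(_ (gauge_has_inf x))[s sB].
by rewrite addrC subrK; exists s.
Qed.

Lemma gauge_le_norm (x : V) : gauge B x <= `|x|.
Proof.
apply/ler_addgt0Pr => e e0.
have xe : 0 < `|x| + e by rewrite ltr_wpDl.
by apply: gauge_le => //; apply: gauge_mem => //; rewrite lerDl ltW.
Qed.

Lemma norm_le_gauge (x : V) : M^-1 * `|x| <= gauge B x.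
Proof.
apply: lb_le_inf => [|r [r0 /Bbounded]]; first by case: (gauge_has_inf x).
rewrite normrZ gtr0_norm ?invr_gt0// ler_pdivrMl// ler_pdivrMl// mulrC.
by [].
Qed.

Lemma gaugeD (x y : V) : gauge B (x + y) <= gauge B x + gauge B y.
Proof.
apply/ler_addgt0Pr => e e0; have e2 : 0 < e / 2 by rewrite divr_gt0.
have [|r rx [r0 Br]] := @gauge_lt x (gauge B x + e / 2); first by rewrite ltrDl.
have [|s sy [s0 Bs]] := @gauge_lt y (gauge B y + e / 2); first by rewrite ltrDl.
have rs0 : 0 < r + s by rewrite addr_gt0.
apply: (@le_trans _ _ (r + s)); last first.
  by rewrite [e]splitr addrACA lerD// ltW.
apply: gauge_le => //.
have -> : (r + s)^-1 *: (x + y) =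
    (r / (r + s)) *: (r^-1 *: x) + (1 - r / (r + s)) *: (s^-1 *: y).
  rewrite scalerDr !scalerA; congr (_ *: _ + _ *: _); field.
    by rewrite !gt_eqF.
  by rewrite !gt_eqF.
apply: Bconvex => //; rewrite divr_ge0 ?(ltW r0) ?(ltW rs0)//=.
by rewrite ler_pdivrMr// mul1r lerDl ltW.
Qed.

Lemma gaugeZ (a : R) (x : V) : gauge B (a *: x) = `|a| * gauge B x.
Proof.
have le b (y : V) : b != 0 -> gauge B (b *: y) <= `|b| * gauge B y.
  move=> b0; have nb : 0 < `|b| by rewrite normr_gt0.
  rewrite -ler_pdivrMl//; apply: lb_le_inf => [|r [r0 Br]].
    by case: (gauge_has_inf y).
  rewrite ler_pdivrMl//; apply: gauge_le; first by rewrite mulr_gt0.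
  have [b_ge0|b_lt0] := leP 0 b.
    by rewrite ger0_norm// scalerA invfM mulrAC mulVf// mul1r.
  rewrite ltr0_norm// scalerA invfM mulrAC invrN mulNr mulVf// mulN1r scaleNr.
  exact: Bsym.
have [->|a0] := eqVneq a 0.
  rewrite scale0r normr0 mul0r; apply/eqP; rewrite eq_le.
  rewrite -[X in _ <= X](normr0 V) gauge_le_norm/=.
  by apply: le_trans (norm_le_gauge 0); rewrite normr0 mulr0.
apply/eqP; rewrite eq_le le// andTb.
by rewrite -ler_pdivlMl ?normr_gt0// -normfV -{1}[x](scalerK a0) le// invr_neq0.
Qed.

Lemma gauge_lower : exists2 c, 0 < c & forall x : V, c * `|x| <= gauge B x.
Proof. by exists M^-1; [rewrite invr_gt0|exact: norm_le_gauge]. Qed.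

Lemma gauge_upper : exists C, forall x : V, gauge B x <= C * `|x|.
Proof. by exists 1 => x; rewrite mul1r gauge_le_norm. Qed.

Definition gauge_norm : equiv_norm V :=
  EquivNorm gaugeD gaugeZ gauge_lower gauge_upper.

End gauge.

Section diagonal.
Variable R : realType.

(* The closed unit ball of l_2, as a set of sequences. *)
Definition l2_ball : set (nat -> R) :=
  [set a | (\esum_(n in [set: nat]) (a n ^+ 2)%:E <= 1)%E].

(* The set B_{l_1} + S_Phi(B_{l_2}), where S_Phi(a)(n) = Phi(n) a(n); when Phi is
   summable, S_Phi(a) lies in l_1 for every a in l_2. *)
Definition diag_ball (Phi : nat -> R) : set (l1 R nat) :=
  [set x | exists2 b : l1 R nat, `|b| <= 1 &
    exists2 a, l2_ball a & forall n, x n = b n + Phi n * a n].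

Lemma l2_ball_le1 a n : l2_ball a -> `|a n| <= 1.
Proof.
move=> a1; rewrite -(@ler_pXn2r _ 2)// ?nnegrE// expr1n -normrX ger0_norm ?sqr_ge0//.
rewrite -lee_fin; apply: le_trans a1; apply: esum_ge; exists [set n] => //.
by rewrite fsbig_set1.
Qed.

Lemma diag_ball_ball (Phi : nat -> R) (x : l1 R nat) : `|x| <= 1 -> diag_ball Phi x.
Proof.
move=> x1; exists x => //; exists (fun=> 0) => [|n]; last by rewrite mulr0 addr0.
by rewrite /l2_ball/= esum1// => n _; rewrite expr0n.
Qed.

Lemma diag_ball_sym (Phi : nat -> R) (x : l1 R nat) : diag_ball Phi x -> diag_ball Phi (- x).
Proof.
move=> [b b1 [a a1 xE]]; exists (- b); first by rewrite normrN.
exists (fun n => - a n) => [|n].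
  by rewrite /l2_ball/=; under eq_esum do rewrite sqrrN.
by rewrite !l1_oppE xE opprD mulrN.
Qed.

Lemma diag_ball_convex (Phi : nat -> R) (x y : l1 R nat) t :
  diag_ball Phi x -> diag_ball Phi y -> 0 <= t <= 1 ->
  diag_ball Phi (t *: x + (1 - t) *: y).
Proof.
move=> [b b1 [a a1 xE]] [b' b'1 [a' a'1 yE]] /andP[t0 t1].
have t1' : 0 <= 1 - t by rewrite subr_ge0.
exists (t *: b + (1 - t) *: b').
  rewrite (le_trans (ler_normD _ _))// !normrZ !ger0_norm//.
  by rewrite -[leRHS](subrK t) addrC lerD// ler_piMr.
exists (fun n => t * a n + (1 - t) * a' n) => [|n]; last first.
  by rewrite !l1_addE !l1_scaleE xE yE; ring.
rewrite /l2_ball/=.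
apply: (@le_trans _ _ (t%:E * (\esum_(n in [set: nat]) (a n ^+ 2)%:E) +
    (1 - t)%:E * (\esum_(n in [set: nat]) (a' n ^+ 2)%:E))%E); last first.
  apply: (@le_trans _ _ (t%:E + (1 - t)%:E)%E); last by rewrite -EFinD addrC subrK.
  apply: leeD.
    by rewrite -[leRHS]mule1 lee_wpmul2l// lee_fin.
  by rewrite -[leRHS]mule1 lee_wpmul2l// lee_fin.
apply: le_trans (leeD (esumZ_le (f := fun n => (a n ^+ 2)%:E) _ _)
  (esumZ_le (f := fun n => (a' n ^+ 2)%:E) _ _)); rewrite ?lee_fin//.
  rewrite -esumD.
  - apply: le_esum => n _; rewrite -!EFinM -EFinD lee_fin -subr_ge0.
    have -> : t * a n ^+ 2 + (1 - t) * a' n ^+ 2 - (t * a n + (1 - t) * a' n) ^+ 2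
      = t * (1 - t) * (a n - a' n) ^+ 2 by ring.
    by rewrite mulr_ge0 ?sqr_ge0// mulr_ge0.
  - by move=> n _; rewrite mule_ge0// lee_fin ?sqr_ge0.
  - by move=> n _; rewrite mule_ge0// lee_fin ?sqr_ge0.
- by move=> n; rewrite lee_fin sqr_ge0.
- by move=> n; rewrite lee_fin sqr_ge0.
Qed.

Lemma diag_ball_bounded (Phi : nat -> R) (C : R) :
  (\esum_(n in [set: nat]) `|Phi n|%:E <= C%:E)%E ->
  forall x, diag_ball Phi x -> `|x| <= 1 + C.
Proof.
move=> PhiC x [b b1 [a a1 xE]].
rewrite -lee_fin [X in (X%:E <= _)%E]/(l1_norm x) -l1_esum.
apply: (@le_trans _ _ (\esum_(n in [set: nat]) (`|b n|%:E + `|Phi n|%:E)))%E.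
  apply: le_esum => n _; rewrite xE -EFinD lee_fin.
  rewrite (le_trans (ler_normD _ _))// lerD2l normrM ler_piMr//.
  exact: l2_ball_le1.
by rewrite esumD// EFinD leeD// l1_esum lee_fin.
Qed.

Lemma esum_nat_le (f : nat -> R) (c : R) : (forall n, 0 <= f n) ->
  (forall k, \sum_(i < k) f i <= c) ->
  (\esum_(n in [set: nat]) (f n)%:E <= c%:E)%E.
Proof.
move=> f0 fc; rewrite -nneseries_esumT; last by move=> n; rewrite lee_fin.
apply: lime_le; first by apply: is_cvg_nneseries => n _ _; rewrite lee_fin.
by apply: nearW => k; rewrite big_mkord sumEFin lee_fin.
Qed.

Lemma sum_le_esum_nat (f : nat -> R) (c : R) k : (forall n, 0 <= f n) ->
  (\esum_(n in [set: nat]) (f n)%:E <= c%:E)%E -> \sum_(i < k) f i <= c.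
Proof.
move=> f0; rewrite -nneseries_esumT; last by move=> n; rewrite lee_fin.
move=> fc; rewrite -lee_fin; apply: le_trans fc.
rewrite -sumEFin -(big_mkord xpredT (fun i => (f i)%:E)).
by apply: nneseries_lim_ge => n _ _; rewrite lee_fin.
Qed.

Lemma diag_ball_gauge (Phi : nat -> R) (C : R) (x : l1 R nat) :
  (\esum_(n in [set: nat]) `|Phi n|%:E <= C%:E)%E ->
  gauge (diag_ball Phi) x <= 1 -> diag_ball Phi x.
Proof.
move=> PhiC gx.
pose P (e : R) (a : nat -> R) k :=
  \sum_(i < k) a i ^+ 2 <= (1 + e) ^+ 2 /\
  \sum_(i < k) `|x i - Phi i * a i| <= 1 + e.
pose X : topologicalType := prod_topology (fun _ : nat => R : topologicalType).
have approx j : exists a : nat -> R,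
    (forall i, - 2 <= a i <= 2) /\ forall k, P j.+1%:R^-1 a k.
  have e0 : 0 < j.+1%:R^-1 :> R by rewrite invr_gt0.
  have e1 : j.+1%:R^-1 <= 1 :> R by rewrite invf_le1// ler1n.
  move: e0 e1; set e := j.+1%:R^-1 => e0 e1.
  have := @gauge_lt _ _ (diag_ball Phi) (@diag_ball_ball Phi) x (1 + e).
  case=> [|r re [r0 [b b1 [a a1 xE]]]]; first by rewrite (le_lt_trans gx)// ltrDl.
  have xrE i : x i = r * (b i + Phi i * a i).
    by rewrite -xE l1_scaleE mulrA divff ?gt_eqF// mul1r.
  exists (fun i => r * a i); split=> [i|k].
    rewrite -ler_norml normrM gtr0_norm// -[leRHS]mulr1.
    rewrite ler_pM ?l2_ball_le1 ?(ltW r0)//.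
    by rewrite (le_trans (ltW re))// lerD2l.
  split.
    under eq_bigr do rewrite exprMn.
    rewrite -mulr_sumr -[leRHS]mulr1 ler_pM ?sqr_ge0 ?sumr_ge0//.
    - by move=> i _; rewrite sqr_ge0.
    - by rewrite ler_pXn2r// ?nnegrE ?(ltW r0) ?(ltW re)// addr_ge0// ltW.
    - by apply: (@sum_le_esum_nat (fun i => a i ^+ 2)) => // n; rewrite sqr_ge0.
  under eq_bigr => i _.
    rewrite xrE mulrDr mulrCA addrK normrM gtr0_norm//.
    over.
  rewrite -mulr_sumr -[leRHS]mulr1 ler_pM ?(ltW r0) ?(ltW re) ?sumr_ge0//.
  apply: (@sum_le_esum_nat (fun i => `|b i|)) => //.
  by rewrite l1_esum lee_fin.
have {approx} [a_ a_P] := choice approx.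
have : compact [set f : X | forall i, `[- 2, 2]%classic (f i)].
  by apply: (@tychonoff nat (fun=> R) (fun=> `[- 2, 2]%classic)) => i; exact: segment_compact.
move=> /(_ ((a_ : nat -> X) @ \oo) _)[|a [_ acl]].
  exists 0%N => // j _ i /=; rewrite in_itv/=.
  by have [] := a_P j.
have coord i : continuous (fun f : X => f i).
  exact: (@proj_continuous nat (fun=> R) i).
have limit (g : X -> R) (c : nat -> R) (d : R) : continuous g ->
    c @ \oo --> d -> (forall j, g (a_ j) <= c j) -> g a <= d.
  move=> cg cd gc; apply/ler_addgt0Pr => e e0; rewrite leNgt; apply/negP => lt.
  have A : \forall f \near (a : X), d + e < g f.
    exact: (cvgr_gt _ (cg a) _ lt).
  have B : \forall j \near \oo, g (a_ j) <= d + e.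
    near=> j; apply: (le_trans (gc j)); near: j.
    apply: (cvgr_le d cd); by rewrite ltrDl.
  have [f [/= ]] := acl [set f | g f <= d + e] _ B A.
  by rewrite leNgt => /negP.
have csum (h : nat -> X -> R) k : (forall i, continuous (h i)) ->
    continuous (fun f => \sum_(i < k) h i f).
  move=> ch; elim: k => [|k IH] f.
    have -> : (fun f : X => \sum_(i < 0) h i f) = cst 0.
      by apply/funext => ?; rewrite big_ord0.
    exact: (@cst_continuous X R 0 f).
  have -> : (fun f : X => \sum_(i < k.+1) h i f) =
      (fun f => \sum_(i < k) h i f + h k f).
    by apply/funext => ?; rewrite big_ord_recr.
  exact: (@continuousD R R X (fun f => \sum_(i < k) h i f) (h k) f (IH f) (ch k f)).
have harm : (fun j => 1 + j.+1%:R^-1 : R) @ \oo --> (1 : R).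
  rewrite -[X in _ --> X]addr0; apply: cvgD; first exact: cvg_cst.
  exact: cvg_harmonic.
have a_sq k : \sum_(i < k) a i ^+ 2 <= 1.
  apply: (limit (fun f => \sum_(i < k) f i ^+ 2) (fun j => (1 + j.+1%:R^-1) ^+ 2)).
  - apply: (csum (fun i f => f i ^+ 2)) => i f.
    exact: (@continuous_comp X R R (fun f => f i) (fun y => y ^+ 2) f
      (coord i f) (@exprn_continuous R 2 (f i))).
  - rewrite -[X in _ --> X](mulr1 1); exact: cvgM.
  - by move=> j; have [_ /(_ k)[]] := a_P j.
have a_x k : \sum_(i < k) `|x i - Phi i * a i| <= 1.
  apply: (limit (fun f => \sum_(i < k) `|x i - Phi i * f i|) (fun j => (1 + j.+1%:R^-1))) => //.
  - apply: (csum (fun i f => `|x i - Phi i * f i|)) => i f.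
    apply: (@continuous_comp X R R (fun f => f i) (fun y => `|x i - Phi i * y|) f
      (coord i f)).
    apply: cvg_norm; apply: cvgB; first exact: cvg_cst.
    by apply: cvgM; [exact: cvg_cst|exact: cvg_id].
  - by move=> j; have [_ /(_ k)[]] := a_P j.
have b_sum : (\esum_(n in [set: nat]) `|x n - Phi n * a n|%:E <= 1%:E)%E.
  exact: esum_nat_le.
exists (L1 (esum_le_summable b_sum)).
  by rewrite -lee_fin [X in (X%:E <= _)%E]/(l1_norm _) -l1_esum.
exists a => [|n]; last by rewrite /= subrK.
by apply: esum_nat_le => // n; rewrite sqr_ge0.
Unshelve. all: by end_near. Qed.

End diagonal.

Section renorming_of_c0.
Variables (R : realType) (N : equiv_norm (c0 R)).
Variable T : operator (l1 R (nat * nat)%type) (dual (renorm N)).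

Lemma half_ge0 n : 0 <= 2^-1 ^+ n :> R.
Proof. by rewrite exprn_ge0// invr_ge0. Qed.

(* The index sets {1, 2, ...} are represented by nat, position k standing for
   k + 1: hence the exponents m.+1, n.+1 and the factor m.+1%:R below. *)
Definition vstar (n m : nat) : dual (renorm N) := T (l1_unit R (n, m)).

Definition Phi (m n : nat) : R :=
  2^-1 ^+ m.+1 * 2^-1 ^+ n.+1 * `|vstar n m|.

(* The norm |.|_m on l_1; diag_norm_unit_ball identifies its closed unit ball. *)
Definition diag_norm (m : nat) (x : l1 R nat) : R := gauge (diag_ball (Phi m)) x.

Lemma esum_half (C : R) : 0 <= C ->
  (\esum_(n in [set: nat]) (C * 2^-1 ^+ n.+1)%:E = C%:E)%E.
Proof.
move=> C0; rewrite -nneseries_esumT; last first.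
  by move=> n; rewrite lee_fin mulr_ge0// half_ge0.
have := @cvg_geometric_eseries_half R C 0%N; rewrite expr0 divr1 => /cvg_lim <-//.
congr (limn _); apply/funext => n; apply: eq_bigr => i _.
by rewrite addn1 exprVn natrX.
Qed.

Lemma vstar_le n m : `|vstar n m| <= `|T|.
Proof.
apply: (le_trans (opnorm_ge T _)); rewrite ler_piMr//; first exact: opnorm_ge0.
by rewrite norm_l1_unit.
Qed.

Lemma vstar_app_le n m (x : c0 R) : `|vstar n m x| <= `|T| * N x.
Proof.
apply: (le_trans (opnorm_ge (vstar n m) x)).
by rewrite ler_pM ?normr_ge0 ?opnorm_ge0//; exact: vstar_le.
Qed.

Definition Rmap_fun (m : nat) (x : c0 R) (n : nat) : R :=
  m.+1%:R * 2^-1 ^+ m.+1 * 2^-1 ^+ n.+1 * vstar n m x.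

Lemma Rmap_fun_le m x :
  (\esum_(n in [set: nat]) `|Rmap_fun m x n|%:E <=
   (m.+1%:R * 2^-1 ^+ m.+1 * (`|T| * N x))%:E)%E.
Proof.
have Nx : 0 <= N x by rewrite -[N x]/(`|x : renorm N|).
rewrite -esum_half; last by rewrite !mulr_ge0// half_ge0.
apply: le_esum => n _; rewrite lee_fin /Rmap_fun.
rewrite normrM ger0_norm ?mulr_ge0 ?half_ge0//.
by rewrite mulrAC ler_wpM2r ?half_ge0// ler_wpM2l ?vstar_app_le// mulr_ge0 ?half_ge0.
Qed.

Definition Rmap (m : nat) (x : c0 R) : l1 R nat :=
  L1 (esum_le_summable (Rmap_fun_le m x)).

(* The norm p; the series converges by p_series_cvg. *)
Definition p_norm (x : c0 R) : R :=
  N x + limn (series (fun m => diag_norm m (Rmap m x))).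

Lemma Rmap_le m x : `|Rmap m x| <= m.+1%:R * 2^-1 ^+ m.+1 * (`|T| * N x).
Proof. by rewrite -lee_fin -[X in (X%:E <= _)%E]/(l1_norm _) -l1_esum Rmap_fun_le. Qed.

Lemma RmapD m x y : Rmap m (x + y) = Rmap m x + Rmap m y.
Proof.
apply/val_inj/funext => n; rewrite /= /Rmap_fun.
by rewrite (op_morphD (vstar n m) x y) mulrDr.
Qed.

Lemma RmapZ m a x : Rmap m (a *: x) = a *: Rmap m x.
Proof.
apply/val_inj/funext => n; rewrite /= /Rmap_fun.
by rewrite (op_morphZ (vstar n m) a x) mulrCA.
Qed.

Lemma Phi_esum m : (\esum_(n in [set: nat]) `|Phi m n|%:E <= (`|T|)%:E)%E.
Proof.
rewrite -(esum_half (normr_ge0 T)); apply: le_esum => n _.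
rewrite lee_fin /Phi ger0_norm ?mulr_ge0 ?half_ge0//.
rewrite mulrAC ler_wpM2r ?half_ge0// -[leRHS]mul1r ler_pM ?half_ge0 ?vstar_le//.
by rewrite exprn_ile1 ?invr_ge0// invf_le1// ler1n.
Qed.

Lemma diag_norm_bound_gt0 : 0 < 1 + `|T|.
Proof. by rewrite ltr_wpDr. Qed.

Definition diag_equiv_norm (m : nat) : equiv_norm (l1 R nat) :=
  gauge_norm diag_norm_bound_gt0 (@diag_ball_ball R (Phi m))
    (diag_ball_bounded (Phi_esum m)) (@diag_ball_sym R (Phi m))
    (@diag_ball_convex R (Phi m)).

Lemma diag_norm_unit_ball m :
  [set x | diag_norm m x <= 1] = diag_ball (Phi m).
Proof.
apply/seteqP; split=> x /= => [|Bx]; first exact: diag_ball_gauge (Phi_esum m).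
by apply: (gauge_le (@diag_ball_ball R (Phi m))); rewrite ?invr1 ?scale1r.
Qed.

Lemma diag_equiv_normE m x : diag_norm m x = diag_equiv_norm m x.
Proof. by []. Qed.

Lemma diag_norm_le m x : diag_norm m x <= `|x|.
Proof. exact: gauge_le_norm (@diag_ball_ball R (Phi m)) x. Qed.

Lemma diag_norm_ge0 m x : 0 <= diag_norm m x.
Proof. by rewrite -[diag_norm m x]/(`|x : renorm (diag_equiv_norm m)|). Qed.

Lemma half_series k : series (fun m => m.+1%:R * 2^-1 ^+ m.+1 : R) k <= 2.
Proof.
suff -> : series (fun m => m.+1%:R * 2^-1 ^+ m.+1 : R) k = 2 - k.+2%:R * 2^-1 ^+ k.
  by rewrite gerBl mulr_ge0// half_ge0.
rewrite /series/=; elim: k => [|k IH]; first by rewrite big_geq// expr0 mulr1 subrr.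
by rewrite big_nat_recr//= IH exprS -!natr1; field.
Qed.

Lemma p_series_le x k :
  series (fun m => diag_norm m (Rmap m x)) k <= 2 * (`|T| * N x).
Proof.
apply: (@le_trans _ _ (series (fun m => m.+1%:R * 2^-1 ^+ m.+1 : R) k * (`|T| * N x))).
  rewrite /series/= mulr_suml; apply: ler_sum => m _.
  exact: le_trans (diag_norm_le _ _) (Rmap_le _ _).
rewrite ler_wpM2r ?half_series// mulr_ge0//.
by rewrite -[N x]/(`|x : renorm N|).
Qed.

Lemma p_series_nd x :
  nondecreasing_seq (series (fun m => diag_norm m (Rmap m x))).
Proof. by apply: nondecreasing_series => m _ _; exact: diag_norm_ge0. Qed.

Lemma p_series_cvg x : cvgn (series (fun m => diag_norm m (Rmap m x))).
Proof.
apply: nondecreasing_is_cvgn; first exact: p_series_nd.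
by exists (2 * (`|T| * N x)) => _ [k _ <-]; exact: p_series_le.
Qed.

Lemma p_normD x y : p_norm (x + y) <= p_norm x + p_norm y.
Proof.
rewrite /p_norm addrACA lerD ?enormD// -lim_seriesD; try exact: p_series_cvg.
apply: lim_series_le => [||m]; first exact: p_series_cvg.
  by apply: is_cvg_seriesD; exact: p_series_cvg.
by rewrite RmapD !diag_equiv_normE; exact: enormD.
Qed.

Lemma p_normZ a x : p_norm (a *: x) = `|a| * p_norm x.
Proof.
rewrite /p_norm mulrDr enormZ; congr (_ + _).
rewrite -[RHS](lim_seriesZ `|a| (@p_series_cvg x)).
congr (limn (series _)); apply/funext => m.
by rewrite RmapZ !diag_equiv_normE enormZ.
Qed.

Lemma p_norm_lower : exists2 c, 0 < c & forall x, c * `|x| <= p_norm x.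
Proof.
have [c c0 cN] := enorm_lower N; exists c => // x.
rewrite -[leLHS]addr0 lerD// limr_ge//; first exact: p_series_cvg.
by apply: nearW => k; apply: sumr_ge0 => m _; exact: diag_norm_ge0.
Qed.

Lemma p_norm_upper : exists C, forall x, p_norm x <= C * `|x|.
Proof.
have [C CN] := enorm_upper N; exists ((1 + 2 * `|T|) * C) => x.
apply: (@le_trans _ _ ((1 + 2 * `|T|) * N x)); last first.
  by rewrite -mulrA ler_wpM2l// addr_ge0// mulr_ge0.
rewrite mulrDl mul1r lerD2l limr_le//; first exact: p_series_cvg.
by apply: nearW => k; rewrite -mulrA; exact: p_series_le.
Qed.

Definition p_equiv_norm : equiv_norm (c0 R) :=
  EquivNorm p_normD p_normZ p_norm_lower p_norm_upper.

Definition frakX : normedModType R := renorm p_equiv_norm.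

End renorming_of_c0.

(* Main.v *)
Require Import Defs.
From HB Require Import structures.
From mathcomp Require Import all_boot all_order all_algebra.
From mathcomp Require Import all_classical all_reals all_analysis.
From mathcomp Require Import ring lra.

Set Implicit Arguments.
Unset Strict Implicit.
Unset Printing Implicit Defensive.

Import Order.TTheory GRing.Theory Num.Theory.
Import numFieldNormedType.Exports.
Local Open Scope classical_set_scope.
Local Open Scope ring_scope.

(* Fix m and put r = p - |R_m(.)|_m, a seminorm.  By Hahn-Banach the dual unit ball
   of p consists of the functionals f + R_m^* g with f <= r and g <= |.|_m; hence
   p^** = r^** + |R_m^**(.)|_m, and if |x| = |y| = 1 and |x + y| = 2 in the bidual,
   then |.|_m is additive on the pair R_m^** x, R_m^** y of vectors of l_1.  Split
   each of them as an l_1 part plus an l_2 part, according to the unit ball of |.|_m: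
   additivity forces the l_1 parts b, b' to satisfy b(n) b'(n) >= 0 for all n.  At
   w = v_{n,m} / |v_{n,m}| the definition of R_m gives
   m x(w) = |R_m^** x|_m (b(n) / Phi_m(n) + a(n)) with a in the unit ball of l_2, so
   m x(w) > 1 forces b(n) > 0; likewise m y(w) < -1 forces b'(n) < 0.  Taking m large
   and approximating by such w, no element f of S_Y has x(f) > 0 > y(f).  By density
   x > 0 implies y >= 0 on the whole dual, so y is a nonnegative multiple of x, and
   y = x.  Smoothness follows because a strictly convex dual makes supporting
   functionals unique. *)

Lemma op_le (R : realType) (V W : normedModType R) (f : operator V W) x :
  `|f x| <= `|f| * `|x|.
Proof. exact: opnorm_ge. Qed.

Lemma op_morph0 (R : realType) (V W : normedModType R) (f : operator V W) :
  f 0 = 0.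
Proof. exact: linear0. Qed.

Lemma op_morphB (R : realType) (V W : normedModType R) (f : operator V W) x y :
  f (x - y) = f x - f y.
Proof. exact: linearB. Qed.

Lemma op_sumE (R : realType) (V W : normedModType R) (I : Type) (r : seq I)
  (F : I -> operator V W) x : (\sum_(i <- r) F i) x = \sum_(i <- r) F i x.
Proof. by elim/big_ind2: _ => // f y g z <- <-. Qed.

(** * The Hahn-Banach theorem for sublinear functionals *)

Section hahn_banach.
Variables (R : realType) (V : lmodType R).
Implicit Types (q P : V -> R) (C : set (V * R)).

Definition sublinear q :=
  (forall x y, q (x + y) <= q x + q y) /\
  (forall (t : R) x, 0 <= t -> q (t *: x) = t * q x).

Lemma sublinear0 q : sublinear q -> q 0 = 0.
Proof. by case=> _ qZ; have := qZ 0 0 (lexx 0); rewrite scale0r mul0r. Qed.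

Lemma sublinearN q x : sublinear q -> - q (- x) <= q x.
Proof.
move=> sq; have [qD _] := sq.
by have := qD x (- x); rewrite subrr sublinear0//; lra.
Qed.

Lemma pos_homogeneous_le q : (forall (t : R) x, 0 < t -> q (t *: x) <= t * q x) ->
  q 0 = 0 -> forall (t : R) x, 0 <= t -> q (t *: x) = t * q x.
Proof.
move=> qle q0 t x; rewrite le_eqVlt => /predU1P[<-|t0].
  by rewrite scale0r mul0r.
apply/eqP; rewrite eq_le qle//= mulrC -ler_pdivlMr// mulrC.
by apply: le_trans (qle _ _ _); rewrite ?invr_gt0// scalerA mulVf ?gt_eqF// scale1r.
Qed.

(** A pair (x, a) stands for the demand a <= f x on the linear functional f sought; such demands can
    be added and multiplied by positive scalars. *)
Definition cone C :=
  [/\ C (0, 0), (forall x y, C x -> C y -> C (x + y)) &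
      forall (t : R) x, 0 < t -> C x -> C (t *: x.1, t * x.2)].

Definition below q C := forall c, C c -> c.2 <= q c.1.

Definition ray (x : V) (a : R) : set (V * R) :=
  [set c | exists2 t, 0 <= t & c = (t *: x, t * a)].

Lemma cone_ray x a : cone (ray x a).
Proof.
split=> [|_ _ [r r0 ->] [t t0 ->]|r _ r0 [t t0 ->]].
- by exists 0; rewrite // scale0r mul0r.
- by exists (r + t); rewrite ?addr_ge0//= scalerDl mulrDl.
- by exists (r * t); rewrite ?mulr_ge0 ?(ltW r0)//= scalerA mulrA.
Qed.

Lemma mem_ray x a : ray x a (x, a).
Proof. by exists 1; rewrite ?scale1r ?mul1r. Qed.

Lemma below_ray q x : sublinear q -> below q (ray x (q x)).
Proof. by case=> _ qZ _ [t t0 ->] /=; rewrite qZ. Qed.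

(** For [q] sublinear and a cone [C] below it, the linear functionals below [inf_conv q C] are
    exactly those f <= q with a <= f x for all (x, a) in [C]. *)
Definition inf_conv q C x : R := inf [set q (x + c.1) - c.2 | c in C].

Section inf_conv.
Variables (q : V -> R) (C : set (V * R)).
Hypotheses (sq : sublinear q) (coneC : cone C) (Cq : below q C).

Lemma inf_conv_has_inf x : has_inf [set q (x + c.1) - c.2 | c in C].
Proof.
have [C0 _ _] := coneC; have [qD _] := sq.
split; first by exists (q (x + 0) - 0), (0, 0).
exists (- q (- x)) => _ [c Cc <-].
have := qD (x + c.1) (- x); rewrite addrAC subrr add0r.
by have := Cq Cc; lra.
Qed.

Lemma inf_conv_le x c : C c -> inf_conv q C x <= q (x + c.1) - c.2.
Proof. by move=> Cc; apply: ge_inf; [case: (inf_conv_has_inf x)|exists c]. Qed.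

Lemma inf_conv_ge x b : (forall c, C c -> b <= q (x + c.1) - c.2) ->
  b <= inf_conv q C x.
Proof.
move=> bC; apply: lb_le_inf; first by case: (inf_conv_has_inf x).
by move=> _ [c Cc <-]; exact: bC.
Qed.

Lemma inf_conv_le_id x : inf_conv q C x <= q x.
Proof.
have [C0 _ _] := coneC.
by apply: (le_trans (inf_conv_le x C0)); rewrite addr0 subr0.
Qed.

Lemma inf_conv_sublinear : sublinear (inf_conv q C).
Proof.
have [C0 CD CZ] := coneC; have [qD qZ] := sq.
split=> [x y|].
  rewrite -lerBlDr; apply: inf_conv_ge => c Cc.
  rewrite lerBlDr -lerBlDl; apply: inf_conv_ge => d Cd.
  rewrite lerBlDl; apply: (le_trans (inf_conv_le _ (CD _ _ Cc Cd))) => /=.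
  have := qD (x + c.1) (y + d.1).
  by rewrite addrACA (addrC x y) /=; lra.
apply: pos_homogeneous_le => [t x t0|].
  rewrite mulrC -ler_pdivrMr//; apply: inf_conv_ge => c Cc.
  rewrite ler_pdivrMr//; apply: (le_trans (inf_conv_le _ (CZ _ _ t0 Cc))) => /=.
  by rewrite -scalerDr (qZ _ _ (ltW t0)) mulrBl (mulrC t) (mulrC t).
apply/eqP; rewrite eq_le; apply/andP; split.
  by apply: le_trans (inf_conv_le_id 0) _; rewrite sublinear0.
by apply: inf_conv_ge => c Cc; rewrite add0r subr_ge0; exact: Cq.
Qed.

End inf_conv.

Lemma sublinear_additive_linear q : sublinear q ->
  (forall x y, q x + q y <= q (x + y)) -> linear q.
Proof.
move=> sq qsup; have [qsub qZ] := sq.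
have qD x y : q (x + y) = q x + q y by apply/eqP; rewrite eq_le qsub qsup.
have qN x : q (- x) = - q x.
  by apply/eqP; rewrite -addr_eq0 -qD addNr sublinear0.
move=> a x y; rewrite qD; congr (_ + _).
have [a0|/ltW a0] := leP 0 a; first exact: qZ.
rewrite -[a]opprK scaleNr qN qZ ?oppr_ge0//.
by rewrite /GRing.scale/= [RHS]mulNr.
Qed.

(** Convolving [q] with the ray through (y, q y) gives a sublinear functional below [q], hence [q]
    itself; the bound at that pair then reads q x <= q (x + y) - q y. *)
Lemma minimal_sublinear_linear q : sublinear q ->
  (forall q', sublinear q' -> (forall x, q' x <= q x) -> q' = q) -> linear q.
Proof.
move=> sq qmin; apply: sublinear_additive_linear => // x y.
have coneC := cone_ray y (q y); have Cq := below_ray (x := y) sq.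
have qE : inf_conv q (ray y (q y)) = q.
  by apply: qmin => [|z]; [exact: inf_conv_sublinear|exact: inf_conv_le_id].
by have := inf_conv_le sq coneC Cq x (mem_ray y (q y)); rewrite qE /=; lra.
Qed.

Lemma minimal_sublinear_exists P : sublinear P ->
  exists q, [/\ sublinear q, (forall x, q x <= P x) &
    forall q', sublinear q' -> (forall x, q' x <= q x) -> q' = q].
Proof.
move=> sP; pose T := {q : V -> R | sublinear q /\ forall x, q x <= P x}.
(* The order is reversed, so Zorn's lemma yields a minimal functional. *)
pose r (s t : T) := `[< forall x, sval t x <= sval s x >].
have [||||t tmin] := @Zorn T r.
- by move=> t; apply/asboolP.
- move=> s t u /asboolP st /asboolP tu; apply/asboolP => x.
  exact: le_trans (tu x) (st x).
- move=> [s ?] [t ?] /asboolP/= st /asboolP/= ts; apply: eq_exist.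
  by apply/funext => x; apply/eqP; rewrite eq_le ts st.
- move=> A Atot; have [->|/set0P[s0 As0]] := eqVneq A set0.
    by exists (exist _ P (conj sP (fun=> lexx _))).
  pose I x := inf [set sval s x | s in A].
  have hI x : has_inf [set sval s x | s in A].
    split; first by exists (sval s0 x), s0.
    exists (- P (- x)) => _ [[s [ss sle]] As <-] /=.
    by apply: le_trans (sublinearN x ss); rewrite lerN2.
  have I_le x s : A s -> I x <= sval s x.
    by move=> As; apply: ge_inf; [case: (hI x)|exists s].
  have I_ge x b : (forall s, A s -> b <= sval s x) -> b <= I x.
    move=> bA; apply: lb_le_inf; first by case: (hI x).
    by move=> _ [s As <-]; exact: bA.
  have sI : sublinear I.
    split=> [x y|].
      rewrite -lerBlDr; apply: (I_ge) => s As; rewrite lerBlDr -lerBlDl.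
      apply: (I_ge) => t At; rewrite lerBlDl.
      (* Members of a chain are comparable, so subadditivity of the smaller of s and t bounds [I] at
         x + y. *)
      have [/asboolP st|/asboolP ts] := Atot _ _ As At.
        apply: (le_trans (I_le _ _ At)); apply: le_trans (proj1 (proj1 (svalP t)) x y) _.
        by rewrite lerD2r.
      apply: (le_trans (I_le _ _ As)); apply: le_trans (proj1 (proj1 (svalP s)) x y) _.
      by rewrite lerD2l.
    apply: pos_homogeneous_le => [t x t0|].
      rewrite mulrC -ler_pdivrMr//; apply: (I_ge) => s As; rewrite ler_pdivrMr//.
      apply: (le_trans (I_le _ _ As)).
      by rewrite (proj2 (proj1 (svalP s)) _ _ (ltW t0)) mulrC.
    have s00 (s : T) : sval s 0 = 0 by exact: sublinear0 (proj1 (svalP s)).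
    apply/eqP; rewrite eq_le -{1}(s00 s0) I_le//=.
    by apply: (I_ge) => s _; rewrite s00.
  have IP x : I x <= P x.
    exact: le_trans (I_le _ _ As0) (proj2 (svalP s0) x).
  exists (exist _ I (conj sI IP)) => s As; apply/asboolP => x /=.
  exact: I_le.
exists (sval t); have [st tP] := svalP t; split=> // q' sq' q't.
have q'P x : q' x <= P x by exact: le_trans (q't x) (tP x).
have := tmin (exist _ q' (conj sq' q'P)).
by move=> <- //; apply/asboolP.
Qed.

(* The Mazur-Orlicz form of the Hahn-Banach theorem: the set C plays the role of
   the graph of the functional to be extended. *)
Theorem hahn_banach P C : sublinear P -> cone C -> below P C ->
  exists f : V -> R, [/\ linear f, (forall x, f x <= P x) & below f C].
Proof.
move=> sP coneC CP.
have [q [sq qP qmin]] := minimal_sublinear_exists (inf_conv_sublinear sP coneC CP).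
have lq : linear q by exact: minimal_sublinear_linear.
exists q; split=> // [x|c Cc].
  exact: le_trans (qP x) (inf_conv_le_id sP coneC CP x).
(* At - c.1 the convolution is at most P 0 - c.2 = - c.2, so q (- c.1) <= - c.2 and c.2 <= q c.1. *)
have := qP (- c.1); have := inf_conv_le sP coneC CP (- c.1) Cc.
rewrite addNr (sublinear0 sP).
by have := sublinearN c.1 sq; lra.
Qed.

End hahn_banach.

(** * Supporting functionals and smoothness *)

Section duality.
Variable R : realType.
Implicit Type V : normedModType R.

Lemma bounded_linear_operator (V W : normedModType R) (f : V -> W) (C : R) :
  linear f -> (forall x, `|f x| <= C * `|x|) -> f \in bounded_operator V W.
Proof.
move=> lf fC; apply/asboolP; split=> //.
pose fl : {linear V -> W} := HB.pack f (GRing.isLinear.Build R V W *:%R f lf).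
suff : bounded_near fl (nbhs 0) by move/linear_bounded_continuous.
apply/bounded_funP => r; exists (`|C| * r) => x xr; apply: (le_trans (fC x)).
by rewrite (le_trans (ler_wpM2r _ (ler_norm C)))// ler_wpM2l.
Qed.

Lemma norm_sublinear V : sublinear (fun x : V => `|x|).
Proof. by split=> [x y|t x t0]; rewrite ?ler_normD// normrZ ger0_norm. Qed.

Lemma linear_le_norm (U : lmodType R) (q f : U -> R) x : linear f ->
  (forall x, f x <= q x) -> (forall x, q (- x) = q x) -> `|f x| <= q x.
Proof.
move=> lf fq qN; rewrite ler_norml fq andbT lerNl -(qN x).
pose fl : {linear U -> R} := HB.pack f (GRing.isLinear.Build R U R *:%R f lf).
by rewrite -[- f x](linearN fl x); exact: fq.
Qed.

Lemma hahn_banach_dual V (C : set (V * R)) : cone C ->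
  below (fun x : V => `|x|) C ->
  exists2 f : dual V, `|f| <= 1 & below f C.
Proof.
move=> coneC CV; have [f [lf fV fC]] := hahn_banach (norm_sublinear V) coneC CV.
have f1 x : `|f x| <= 1 * `|x|.
  by rewrite mul1r; apply: linear_le_norm lf fV (@normrN _ _).
exists (Operator (bounded_linear_operator lf f1)) => //.
by apply: opnorm_le => x x1; apply: le_trans (f1 x) _; rewrite mul1r.
Qed.

Lemma dual_le V (f : dual V) x : `|f| <= 1 -> f x <= `|x|.
Proof.
move=> f1; apply: (le_trans (ler_norm _)); apply: (le_trans (opnorm_ge f x)).
by rewrite -[leRHS]mul1r ler_wpM2r.
Qed.

(** Both functionals have norm 1 and f + g is at least 2 |x| at x, so |f + g| >= 2; strict convexity
    then excludes f <> g. *)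
Lemma supporting_functional_unique V (x : V) (f g : dual V) :
  strictly_convex (dual V) -> x != 0 -> `|f| <= 1 -> `|g| <= 1 ->
  `|x| <= f x -> `|x| <= g x -> f = g.
Proof.
move=> sc x0 f1 g1 fx gx; apply: contrapT => fg.
have nx0 : 0 < `|x| by rewrite normr_gt0.
have norm1 (h : dual V) : `|h| <= 1 -> `|x| <= h x -> `|h| = 1.
  move=> h1 hx; apply/eqP; rewrite eq_le h1/= -(ler_pM2r nx0) mul1r.
  exact: le_trans hx (le_trans (ler_norm _) (opnorm_ge h x)).
have := sc f g (norm1 _ f1 fx) (norm1 _ g1 gx) fg.
rewrite ltNge -(ler_pM2r nx0) mulr_natl mulr2n => /negP; apply.
apply: le_trans (lerD fx gx) _.
exact: le_trans (ler_norm _) (opnorm_ge (f + g : dual V) x).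
Qed.

Lemma strictly_convex_dual_upper V (x h : V) (g : dual V) (e : R) :
  strictly_convex (dual V) -> x != 0 -> `|g| <= 1 -> `|x| <= g x -> 0 < e ->
  exists2 t0, 0 < t0 &
    forall t, 0 < t -> t <= t0 -> `|x + t *: h| - `|x| <= t * (g h + e).
Proof.
move=> sc x0 g1 gx e0; apply: contrapT => none.
set d := g h + e in none *.
(* Otherwise the difference quotients in the direction h all exceed d, and the
   functional a x + b h |-> a |x| + b d, b >= 0, extends to a second supporting
   functional at x. *)
have quot t : 0 < t -> t * d <= `|x + t *: h| - `|x|.
  (* By convexity of the norm, a quotient below [d] at t would bound all quotients at s <= t by [d],
     so t would be a t0 excluded by [none]. *)
  move=> t0; rewrite leNgt; apply/negP => td; apply: none; exists t => // s s0 st.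
  pose k := s / t; have sE : s = k * t by rewrite /k divfK ?gt_eqF.
  have k0 : 0 <= k by rewrite divr_ge0 ?ltW.
  have k1 : 0 <= 1 - k by rewrite subr_ge0 ler_pdivrMr// mul1r.
  clearbody k.
  have -> : x + s *: h = (1 - k) *: x + k *: (x + t *: h).
    by rewrite scalerDr addrA -scalerDl subrK scale1r scalerA sE.
  have : `|(1 - k) *: x + k *: (x + t *: h)| <=
     (1 - k) * `|x| + k * `|x + t *: h|.
    apply: (le_trans (ler_normD _ _)).
    by rewrite !normrZ (ger0_norm k0) (ger0_norm k1).
  have : k * (`|x + t *: h| - `|x|) <= k * (t * d) by rewrite ler_wpM2l ?(ltW td).
  by rewrite sE; lra.
pose C : set (V * R) :=
  [set c | exists a b, 0 <= b /\ c = (a *: x + b *: h, a * `|x| + b * d)].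
have coneC : cone C.
  split=> [|_ _ [a [b [b0 ->]]] [a' [b' [b'0 ->]]]|t _ t0 [a [b [b0 ->]]]].
  - by exists 0, 0; rewrite !scale0r !mul0r !addr0.
  - exists (a + a'), (b + b'); split; first exact: addr_ge0.
    by congr pair; rewrite /= ?scalerDl ?mulrDl addrACA.
  - exists (t * a), (t * b); split; first by rewrite mulr_ge0// ltW.
    by congr pair; rewrite /= ?scalerDr ?mulrDr ?scalerA ?mulrA.
have CV : below (fun x : V => `|x|) C.
  move=> _ [a [b [b0 ->]]] /=.
  have [b00|b_gt0] := eqVneq b 0.
    rewrite b00 mul0r scale0r !addr0 normrZ.
    by rewrite ler_wpM2r// ler_norm.
  have {b_gt0}b0 : 0 < b by rewrite lt0r b_gt0.
  have [a0|a0] := ltP 0 a.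
    have -> : a *: x + b *: h = a *: (x + (b / a) *: h).
      by rewrite scalerDr scalerA mulrC divfK// gt_eqF.
    rewrite normrZ gtr0_norm//.
    have := quot _ (divr_gt0 b0 a0).
    rewrite -(ler_pM2l a0) mulrBr mulrA [a * (b / a)]mulrC divfK ?gt_eqF//.
    lra.
  (* For a <= 0, adding (1 - a) x leads to x + b h, where [quot] at b applies. *)
  have : `|x + b *: h| <= `|a *: x + b *: h| + (1 - a) * `|x|.
    have -> : x + b *: h = (a *: x + b *: h) + (1 - a) *: x.
      by rewrite addrAC -scalerDl (addrC a) subrK scale1r.
    apply: (le_trans (ler_normD _ _)).
    by rewrite normrZ [ `|1 - a|]ger0_norm// subr_ge0 (le_trans a0).
  by have := quot _ b0; lra.
have [f f1 fC] := hahn_banach_dual coneC CV.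
have fx : `|x| <= f x.
  have /fC/= : C (1 *: x + 0 *: h, 1 * `|x| + 0 * d) by exists 1, 0.
  by rewrite scale1r scale0r addr0 mul1r mul0r addr0.
have fh : d <= f h.
  have /fC/= : C (0 *: x + 1 *: h, 0 * `|x| + 1 * d) by exists 0, 1.
  by rewrite scale1r scale0r add0r mul1r mul0r add0r.
have fg := supporting_functional_unique sc x0 f1 g1 fx gx.
by move: fh; rewrite fg /d; lra.
Qed.

(** The derivative at x is a supporting functional g: as a subgradient it bounds the difference
    quotients on one side, and the upper estimates along h and - h bound them up to e on the
    other. *)
Theorem strictly_convex_dual_smooth V : strictly_convex (dual V) -> smooth V.
Proof.
move=> sc x x0.
have [g g1 gC] := hahn_banach_dual (cone_ray x `|x|) (below_ray (norm_sublinear V)).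
have gx : `|x| <= g x by exact: (gC (x, `|x|) (mem_ray _ _)).
exists g => h.
suff D : (fun t : R => t^-1 *: (((fun y : V => `|y|) \o shift x) (t *: h) - `|x|))
    @ 0^' --> g h.
  by split; [exact: cvgP D|exact: cvg_lim D].
apply/cvgrPdist_le => e e0.
have [t1 t10 up1] := strictly_convex_dual_upper h sc x0 g1 gx e0.
have [t2 t20 up2] := strictly_convex_dual_upper (- h) sc x0 g1 gx e0.
have low (t : R) : t * g h <= `|x + t *: h| - `|x|.
  rewrite lerBrDl; apply: le_trans _ (dual_le (x + t *: h) g1).
  by rewrite op_morphD op_morphZ lerD2r.
near=> t.
rewrite /= [t *: h + x]addrC.
have tneq0 : t != 0 by near: t; exact: nbhs_dnbhs_neq.
have tt1 : `|t| <= t1 by near: t; exact: dnbhs0_le.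
have tt2 : `|t| <= t2 by near: t; exact: dnbhs0_le.
have Dt : `|(`|x + t *: h| - `|x|) - t * g h| <= `|t| * e.
  rewrite ger0_norm ?subr_ge0//.
  move: tneq0; rewrite neq_lt => /orP[t_lt0|t_gt0]; last first.
    by rewrite gtr0_norm// in tt1 *; have := up1 _ t_gt0 tt1; lra.
  (* A negative t in direction h is the positive - t in direction - h. *)
  rewrite ltr0_norm// in tt2 *; rewrite -oppr_gt0 in t_lt0.
  have := up2 _ t_lt0 tt2.
  rewrite scalerN scaleNr opprK -[- h]scaleN1r op_morphZ /GRing.scale/=.
  lra.
have -> : g h = t^-1 * (t * g h) by rewrite mulKf.
by rewrite distrC -mulrBr normrM normfV ler_pdivrMl ?normr_gt0.
Unshelve. all: by end_near. Qed.

End duality.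

(** * Geometry of the norm [diag_norm] on l_1 *)

Section diag_norm.
Variables (R : realType) (N : equiv_norm (c0 R)).
Variable T : operator (l1 R (nat * nat)%type) (dual (renorm N)).
Variable m : nat.

Lemma l1_norm_remove (I : choiceType) (w : l1 R I) i :
  `|w| = `|w - w i *: l1_unit R i| + `|w i|.
Proof.
have -> : `|w i| = `|w i *: l1_unit R i| by rewrite normrZ norm_l1_unit mulr1.
apply: EFin_inj; rewrite EFinD.
rewrite -[X in (X%:E = _)%E]/(l1_norm _) -[X in (_ = X%:E + _)%E]/(l1_norm _).
rewrite -[X in (_ = _ + X%:E)%E]/(l1_norm _) -!l1_esum -esumD//.
apply: eq_esum => j _; rewrite -EFinD l1_addE l1_oppE l1_scaleE /=.
have [->|ji] := eqVneq j i; first by rewrite mulr1 subrr normr0 add0r.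
by rewrite mulr0 normr0 subr0 addr0.
Qed.

(** For small e > 0, (b + w) / (1 - e) = (b + e w) / (1 - e) + w with the first term still in the
    unit ball of l_1, so b + w lies in 1 - e times the ball. *)
Lemma diag_norm_lt1 (b w : l1 R nat) : `|b| < 1 ->
  (forall c : l1 R nat, `|c| <= 1 -> diag_ball (Phi T m) (c + w)) ->
  diag_norm T m (b + w) < 1.
Proof.
(* This [e] gives |b| + e |w| <= 1 - e; the factor 2 keeps e < 1. *)
move=> b1 cw; pose e := (1 - `|b|) / (2 * (1 + `|w|)).
have w0 : 0 < 1 + `|w| by rewrite ltr_wpDr.
have e0 : 0 < e by rewrite divr_gt0 ?subr_gt0// mulr_gt0.
have eE : 2 * e * (1 + `|w|) = 1 - `|b|.
  by rewrite /e; field; rewrite gt_eqF.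
have e1 : 0 < 1 - e.
  have : e * (1 + `|w|) >= e by rewrite ler_peMr ?(ltW e0)// lerDl.
  have := normr_ge0 b; lra.
apply: (@le_lt_trans _ _ (1 - e)); last by rewrite gtrBl.
apply: (gauge_le (@diag_ball_ball R (Phi T m))) => //.
have -> : (1 - e)^-1 *: (b + w) = (1 - e)^-1 *: (b + e *: w) + w.
  apply: (scalerI (a := 1 - e)); first by rewrite gt_eqF.
  rewrite [RHS]scalerDr !scalerA mulfV ?gt_eqF// !scale1r -addrA -scalerDl.
  by rewrite (addrC e) subrK scale1r.
apply: cw; rewrite normrZ ger0_norm ?invr_ge0 ?(ltW e1)//.
rewrite ler_pdivrMl// mulr1; apply: (le_trans (ler_normD _ _)).
rewrite normrZ gtr0_norm//; have := normr_ge0 w.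
have : 0 <= e * `|w| by rewrite mulr_ge0 ?(ltW e0).
lra.
Qed.

(** The set [diag_ball] is the whole closed unit ball of the norm, so u divided by its norm belongs
    to it and splits. *)
Lemma diag_norm_decomposition (u : l1 R nat) : 0 < diag_norm T m u ->
  exists (b : l1 R nat) (a : nat -> R), [/\ `|b| <= 1, l2_ball a &
    forall n, u n = diag_norm T m u * (b n + Phi T m n * a n)].
Proof.
move=> u0; set s := diag_norm T m u in u0 *.
have : [set x | diag_norm T m x <= 1] (s^-1 *: u).
  by rewrite /= !diag_equiv_normE enormZ gtr0_norm ?invr_gt0// mulVf// gt_eqF.
rewrite diag_norm_unit_ball => -[b b1 [a a1 E]].
exists b, a; split=> // n.
by rewrite -E l1_scaleE mulrA divff ?gt_eqF// mul1r.
Qed.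

(* If some b n and b' n had opposite signs, the l_1 part of (u + v) / |u + v|
   would have norm < 1, and part of the room could be given to the l_2 part. *)
Lemma diag_norm_additive_sign (u v : l1 R nat) :
  0 < diag_norm T m u -> 0 < diag_norm T m v ->
  diag_norm T m u + diag_norm T m v <= diag_norm T m (u + v) ->
  exists b b' a a' : nat -> R,
  [/\ forall n, 0 <= b n * b' n, forall n, `|a n| <= 1, forall n, `|a' n| <= 1,
      forall n, u n = diag_norm T m u * (b n + Phi T m n * a n) &
      forall n, v n = diag_norm T m v * (b' n + Phi T m n * a' n)].
Proof.
move=> u0 v0 uv.
have [b [a [b1 a1 uE]]] := diag_norm_decomposition u0.
have [b' [a' [b'1 a'1 vE]]] := diag_norm_decomposition v0.
exists b, b', a, a'; split=> // n; do ?[exact: l2_ball_le1].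
rewrite leNgt; apply/negP => bb'; move: uv; apply/negP; rewrite -ltNge.
move: u0 v0 uE vE; set s := diag_norm T m u; set s' := diag_norm T m v.
move=> s0 s'0 uE vE.
have ss'0 : 0 < s + s' by rewrite addr_gt0.
(* With this weight, (u + v) / (s + s') is a convex combination of u / s and v / s'; [d] will
   collect the l_1 parts, [w] and [w'] are the l_2 parts. *)
pose t := s / (s + s').
have tE : (s + s') * t = s by rewrite mulrC divfK ?gt_eqF.
have t0 : 0 < t by rewrite divr_gt0.
have t1 : 0 < 1 - t by rewrite -(pmulr_rgt0 _ ss'0) mulrBr tE mulr1 addrC addKr.
clearbody t.
pose d := t *: b + (1 - t) *: b'.
pose w := s^-1 *: u - b; pose w' := s'^-1 *: v - b'.
have wE k : w k = Phi T m k * a k.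
  by rewrite l1_addE l1_oppE l1_scaleE uE mulKf ?gt_eqF// addrC addKr.
have w'E k : w' k = Phi T m k * a' k.
  by rewrite l1_addE l1_oppE l1_scaleE vE mulKf ?gt_eqF// addrC addKr.
have -> : u + v = (s + s') *: (d + (t *: w + (1 - t) *: w')).
  rewrite addrACA -!scalerDr /w /w' ![_ + (_ - _)]addrC !subrK.
  rewrite scalerDr !scalerA tE mulrBr tE mulr1 [s + s' - s]addrC addKr.
  by rewrite !mulfV ?gt_eqF// !scale1r.
clearbody w w'.
rewrite [diag_norm _ _ _]diag_equiv_normE enormZ -diag_equiv_normE.
rewrite gtr0_norm// -[ltRHS]mulr1 ltr_pM2l//.
apply: diag_norm_lt1 => [|c c1]; last first.
  have -> : c + (t *: w + (1 - t) *: w') = t *: (c + w) + (1 - t) *: (c + w').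
    by rewrite !scalerDr [RHS]addrACA -scalerDl (addrC t) subrK scale1r.
  apply: diag_ball_convex; [| |by rewrite (ltW t0) -subr_ge0 ltW].
    by exists c => //; exists a => // k; rewrite l1_addE wE.
  by exists c => //; exists a' => // k; rewrite l1_addE w'E.
(* Away from n the triangle inequality bounds [d] by the average of [b] and [b']; at n the opposite
   signs make the inequality strict, so |d| < 1. *)
rewrite (l1_norm_remove d n).
have -> : d - d n *: l1_unit R n =
    t *: (b - b n *: l1_unit R n) + (1 - t) *: (b' - b' n *: l1_unit R n).
  rewrite /d l1_addE !l1_scaleE.
  by rewrite [_ *: l1_unit _ _]scalerDl !scalerBr !scalerA opprD addrACA.
have dn : `|d n| < t * `|b n| + (1 - t) * `|b' n|.
  rewrite /d l1_addE !l1_scaleE.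
  have [bn0|bn0] := ltP 0 (b n).
    have b'n0 : b' n < 0 by rewrite -(pmulr_rlt0 _ bn0).
    rewrite (gtr0_norm bn0) (ltr0_norm b'n0) ltr_norml.
    have : 0 < t * b n by rewrite mulr_gt0.
    have : (1 - t) * b' n < 0 by rewrite pmulr_rlt0.
    by move=> ? ?; apply/andP; split; lra.
  have {}bn0 : b n < 0.
    by rewrite lt_neqAle bn0 andbT; apply: contraTneq bb' => ->; rewrite mul0r ltxx.
  have b'n0 : 0 < b' n by rewrite -(nmulr_rlt0 _ bn0).
  rewrite (ltr0_norm bn0) (gtr0_norm b'n0) ltr_norml.
  have : t * b n < 0 by rewrite pmulr_rlt0.
  have : 0 < (1 - t) * b' n by rewrite mulr_gt0.
  by move=> ? ?; apply/andP; split; lra.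
have := ler_normD (t *: (b - b n *: l1_unit R n)) ((1 - t) *: (b' - b' n *: l1_unit R n)).
rewrite !normrZ (gtr0_norm t0) (gtr0_norm t1).
have -> : `|b - b n *: l1_unit R n| = `|b| - `|b n|.
  by rewrite [in RHS](l1_norm_remove b n) addrK.
have -> : `|b' - b' n *: l1_unit R n| = `|b'| - `|b' n|.
  by rewrite [in RHS](l1_norm_remove b' n) addrK.
have : t * `|b| <= t * 1 by rewrite ler_pM2l.
have : (1 - t) * `|b'| <= (1 - t) * 1 by rewrite ler_pM2l.
lra.
Qed.

End diag_norm.

(** * Auxiliary estimates for series and functionals *)

Lemma series_term_le (R : realType) (u : nat -> R) m :
  (forall k, 0 <= u k) -> cvgn (series u) -> u m <= limn (series u).
Proof.
move=> u0 cu; apply: limr_ge => //; near=> k.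
have mk : (m < k)%N by near: k; exact: nbhs_infty_gt.
rewrite /series/= (bigD1_seq m) ?mem_index_iota ?iota_uniq//= lerDl.
by rewrite sumr_ge0.
Unshelve. all: by end_near. Qed.

Lemma l1_tail (R : realType) (u : l1 R nat) (M : R) (K : nat) :
  (forall n, `|u n| <= M * 2^-1 ^+ n.+1) ->
  `|u - \sum_(i < K) u i *: l1_unit R (i : nat)| <= M * 2^-1 ^+ K.
Proof.
move=> uM; set w := _ - _.
have wE n : w n = if (n < K)%N then 0 else u n.
  rewrite /w; elim: K {w} => [|K IH].
    by rewrite big_ord0 subr0.
  rewrite big_ord_recr opprD addrA l1_addE IH l1_oppE l1_scaleE
    /= [in RHS]ltnS [in RHS]leq_eqVlt.
  have [->|nK] := eqVneq n K; first by rewrite ltnn mulr1 subrr.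
  by rewrite mulr0 subr0.
clearbody w; rewrite -lee_fin [X in (X%:E <= _)%E]/(l1_norm _) -l1_esum.
apply: esum_nat_le => // k.
(* Adding the geometric tail beyond max(k, K) to the partial sum makes the induction on k close. *)
suff : \sum_(i < k) `|w i| + M * 2^-1 ^+ maxn k K <= M * 2^-1 ^+ K.
  apply: le_trans; rewrite lerDl mulr_ge0 ?half_ge0//.
  have := le_trans (normr_ge0 _) (uM 0%N).
  by rewrite pmulr_lge0// exprn_gt0// invr_gt0.
elim: k => [|k IH]; first by rewrite big_ord0 add0r max0n.
apply: le_trans IH; rewrite big_ord_recr/= -addrA lerD2l wE.
case: ltnP => kK.
  by rewrite normr0 add0r (maxn_idPr kK).
rewrite (maxn_idPl (leqW kK)).
have := uM k; rewrite exprS; lra.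
Qed.

Lemma dual_norm_le1 (R : realType) (V : normedModType R) (f : dual V) :
  (forall x, f x <= `|x|) -> `|f| <= 1.
Proof.
move=> fle; apply: opnorm_le => x x1; apply: le_trans x1.
exact: linear_le_norm (@op_linear _ _ _ f) fle (@normrN _ _).
Qed.

(** * Duals of the renormed space and adjoints of the operators R_m *)

Section bidual.
Variables (R : realType) (N : equiv_norm (c0 R)).
Variable T : operator (l1 R (nat * nat)%type) (dual (renorm N)).

Let V := frakX T.

Lemma N_ge0 (x : c0 R) : 0 <= N x.
Proof. exact: (normr_ge0 (x : renorm N)). Qed.

Lemma N_le_p (x : V) : N x <= `|x|.
Proof.
rewrite renorm_normE /= /p_norm lerDl limr_ge//; first exact: p_series_cvg.
by apply: nearW => k; apply: sumr_ge0 => m _; exact: diag_norm_ge0.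
Qed.

Lemma dual_incl_subproof (f : dual (renorm N)) :
  (f : V -> R) \in bounded_operator V R.
Proof.
apply: (@bounded_linear_operator _ _ _ _ `|f|); first exact: (@op_linear _ _ _ f).
move=> x; apply: (le_trans (op_le f x)).
by rewrite ler_wpM2l//; exact: N_le_p.
Qed.

Definition dual_incl (f : dual (renorm N)) : dual V :=
  Operator (dual_incl_subproof f).

Lemma dual_incl_linear a f g : dual_incl (a *: f + g) = a *: dual_incl f + dual_incl g.
Proof. exact/val_inj. Qed.

Lemma dual_incl_norm f : `|dual_incl f| <= `|f|.
Proof.
apply: opnorm_le => x x1; apply: (le_trans (op_le f x)).
by rewrite ler_piMr//; exact: le_trans (N_le_p x) x1.
Qed.

(** Both p and [N] are equivalent to the supremum norm, so a functional continuous for p is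
    continuous for [N]. *)
Lemma dual_incl_surj g : exists f, dual_incl f = g.
Proof.
have [C pC] := enorm_upper (p_equiv_norm T).
have [c c0 cN] := enorm_lower N.
have gb : (g : renorm N -> R) \in bounded_operator (renorm N) R.
  apply: (@bounded_linear_operator _ _ _ _ (`|g| * (`|C| * c^-1))).
    exact: (@op_linear _ _ _ g).
  move=> x; apply: (le_trans (op_le g x)).
  rewrite -mulrA ler_wpM2l//; apply: (le_trans (pC x)).
  rewrite -mulrA; set a := (X in C * X).
  have a0 : 0 <= a by exact: normr_ge0.
  have ax : a <= c^-1 * `|x| by rewrite ler_pdivlMl//; exact: cN.
  by rewrite (le_trans (ler_wpM2r a0 (ler_norm C)))// ler_wpM2l.
by exists (Operator gb); exact/val_inj.
Qed.

Lemma restrict_subproof (z : dual (dual V)) :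
  (fun f => z (dual_incl f)) \in bounded_operator (dual (renorm N)) R.
Proof.
apply: (@bounded_linear_operator _ _ _ _ `|z|) => [a f g|f].
  by rewrite dual_incl_linear op_morphD op_morphZ.
apply: (le_trans (op_le z _)).
by rewrite ler_wpM2l// dual_incl_norm.
Qed.

(** The adjoint of [dual_incl]: it lets elements of the bidual act on the v_{n,m} and on Y, which
    live in the dual of [N]. *)
Definition restrict (z : dual (dual V)) : dual (dual (renorm N)) :=
  Operator (restrict_subproof z).

Section fixed_index.
Variable m : nat.

Let s : l1 R nat -> R := diag_norm T m.
Let A : V -> l1 R nat := Rmap T m.
Let coef : R := m.+1%:R * 2^-1 ^+ m.+1.

Lemma coef_ge0 : 0 <= coef.
Proof. by rewrite mulr_ge0// half_ge0. Qed.

Definition rest (x : V) : R := `|x| - s (A x).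

Lemma rest_ge0 x : 0 <= rest x.
Proof.
rewrite subr_ge0 renorm_normE /= /p_norm ler_wpDl ?N_ge0//.
apply: (@series_term_le _ (fun k => diag_norm T k (Rmap T k x))).
  by move=> k; exact: diag_norm_ge0.
exact: p_series_cvg.
Qed.

Lemma diag_normD (u v : l1 R nat) : s (u + v) <= s u + s v.
Proof. by rewrite /s !diag_equiv_normE enormD. Qed.

Lemma diag_normZ (a : R) (u : l1 R nat) : s (a *: u) = `|a| * s u.
Proof. by rewrite /s !diag_equiv_normE enormZ. Qed.

Lemma diag_norm_sublinear : sublinear s.
Proof.
by split=> [u v|t u t0]; [exact: diag_normD|rewrite diag_normZ ger0_norm].
Qed.

(** The triangle defect of p sums the nonnegative defects of [N] and of all the terms, so it is at
    least the defect of the m-th term alone. *)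
Lemma rest_sublinear : sublinear rest.
Proof.
split=> [x y|t x t0]; last first.
  by rewrite /rest normrZ /A RmapZ diag_normZ (ger0_norm t0) mulrBr.
pose gap k := diag_norm T k (Rmap T k x) + diag_norm T k (Rmap T k y)
  - diag_norm T k (Rmap T k (x + y)).
have gap0 k : 0 <= gap k.
  by rewrite subr_ge0 RmapD !diag_equiv_normE enormD.
have cxy := is_cvg_seriesD (@p_series_cvg _ _ T x) (@p_series_cvg _ _ T y).
have := series_term_le m gap0 (is_cvg_seriesB cxy (@p_series_cvg _ _ T (x + y))).
rewrite [limn (series gap)](lim_seriesB cxy (@p_series_cvg _ _ T (x + y))).
rewrite (lim_seriesD (@p_series_cvg _ _ T x) (@p_series_cvg _ _ T y)).
have := enormD N x y.
rewrite /rest !renorm_normE /= /p_norm /gap /s /A.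
lra.
Qed.

Lemma adjoint_subproof (g : dual (l1 R nat)) :
  (fun x => g (A x)) \in bounded_operator V R.
Proof.
apply: (@bounded_linear_operator _ _ _ _ (`|g| * (coef * `|T|))) => [a x y|x].
  by rewrite /A RmapD RmapZ op_morphD op_morphZ.
apply: (le_trans (op_le g _)); rewrite -mulrA ler_wpM2l//.
apply: (le_trans (Rmap_le T m x)); rewrite -/coef -mulrA ler_wpM2l ?coef_ge0//.
by rewrite ler_wpM2l//; exact: N_le_p.
Qed.

Definition adjoint (g : dual (l1 R nat)) : dual V := Operator (adjoint_subproof g).

Definition hat_fun (z : dual (dual V)) (n : nat) : R :=
  coef * 2^-1 ^+ n.+1 * restrict z (vstar T n m).

Lemma hat_fun_le z n : `|hat_fun z n| <= coef * `|T| * `|z| * 2^-1 ^+ n.+1.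
Proof.
rewrite /hat_fun normrM ger0_norm ?mulr_ge0 ?coef_ge0 ?half_ge0//.
rewrite mulrAC ler_wpM2r ?half_ge0// -mulrA ler_wpM2l ?coef_ge0//.
apply: (le_trans (op_le z _)); rewrite mulrC ler_wpM2r//.
exact: le_trans (dual_incl_norm _) (vstar_le T n m).
Qed.

Lemma hat_summable z : hat_fun z \in @absolutely_summable R nat.
Proof.
apply: (@esum_le_summable _ _ _ (coef * `|T| * `|z|)).
rewrite -esum_half ?mulr_ge0 ?coef_ge0//.
by apply: le_esum => n _; rewrite lee_fin hat_fun_le.
Qed.

(* R_m^** z, which lies in l_1 since R_m is compact. *)
Definition hat (z : dual (dual V)) : l1 R nat := L1 (hat_summable z).

Lemma hatE z n : hat z n =
  m.+1%:R * 2^-1 ^+ m.+1 * 2^-1 ^+ n.+1 * restrict z (vstar T n m).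
Proof. by []. Qed.

Lemma hatD x y : hat (x + y) = hat x + hat y.
Proof.
by apply/val_inj/funext => n; rewrite /= /hat_fun -mulrDr.
Qed.

(** Truncating R_m at K coordinates costs a geometrically small norm error on either side, and for
    the truncations the identity is linearity of z and of g. *)
Lemma adjoint_hat (z : dual (dual V)) g : z (adjoint g) = g (hat z).
Proof.
apply/eqP; rewrite -subr_eq0 -normr_le0.
pose M : R := `|z| * (`|g| * (coef * `|T|)) + `|g| * (coef * `|T| * `|z|).
have M0 : 0 <= M by rewrite /M !(addr_ge0, mulr_ge0)// coef_ge0.
suff bound K : `|z (adjoint g) - g (hat z)| <= M * 2^-1 ^+ K.
  have cM : M * 2^-1 ^+ K @[K --> \oo] --> (0 : R).
    apply: (cvg_geometric M).
    by rewrite ger0_norm ?invr_ge0// invf_lt1// ltr1n.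
  rewrite -(cvg_lim _ cM)//; apply: limr_ge; first exact: cvgP cM.
  exact: nearW.
pose G : dual V := \sum_(i < K)
  (coef * 2^-1 ^+ i.+1 * g (l1_unit R (i : nat))) *: dual_incl (vstar T i m).
have gsum (u : l1 R nat) : g (\sum_(i < K) u i *: l1_unit R (i : nat)) =
    \sum_(i < K) u i * g (l1_unit R (i : nat)).
  by rewrite linear_sum; apply: eq_bigr => i _; rewrite linearZ.
have zG : z G = g (\sum_(i < K) hat z i *: l1_unit R (i : nat)).
  rewrite gsum /G linear_sum; apply: eq_bigr => i _.
  by rewrite linearZ /= /hat_fun /GRing.scale/= mulrAC.
have GA : `|adjoint g - G| <= `|g| * (coef * `|T|) * 2^-1 ^+ K.
  apply: opnorm_le => x x1.
  have -> : (adjoint g - G) x = g (A x - \sum_(i < K) A x i *: l1_unit R (i : nat)).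
    rewrite op_morphB gsum [LHS]/(g (A x) - G x); congr (_ - _).
    rewrite op_sumE; apply: eq_bigr => i _.
    by rewrite [LHS]/(_ * _) /= /Rmap_fun mulrAC.
  apply: (le_trans (op_le g _)); rewrite -mulrA ler_wpM2l//.
  apply: l1_tail => n.
  rewrite /= /Rmap_fun normrM ger0_norm ?mulr_ge0 ?coef_ge0 ?half_ge0//.
  rewrite mulrAC ler_wpM2r ?half_ge0// ler_wpM2l ?coef_ge0//.
  apply: (le_trans (vstar_app_le T n m x)).
  by rewrite ler_piMr// (le_trans (N_le_p x)).
have -> : z (adjoint g) - g (hat z) = z (adjoint g - G) -
    g (hat z - \sum_(i < K) hat z i *: l1_unit R (i : nat)).
  by rewrite !op_morphB zG; ring.
apply: (le_trans (ler_normB _ _)); rewrite mulrDl lerD//.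
  by apply: (le_trans (op_le z _)); rewrite -mulrA ler_wpM2l.
apply: (le_trans (op_le g _)); rewrite -[leRHS]mulrA ler_wpM2l//.
by apply: l1_tail => n; exact: hat_fun_le.
Qed.

Lemma diag_norm_norming (u : l1 R nat) : exists2 g : dual (l1 R nat),
  (forall w, g w <= s w) & s u <= g u.
Proof.
have [g [lg gs gC]] := hahn_banach diag_norm_sublinear
  (cone_ray u (s u)) (below_ray diag_norm_sublinear).
have gb w : `|g w| <= 1 * `|w|.
  rewrite mul1r; apply: le_trans (diag_norm_le T m w).
  apply: linear_le_norm lg gs _ => v.
  by rewrite -scaleN1r diag_normZ normrN1 mul1r.
exists (Operator (bounded_linear_operator lg gb)) => //=.
exact: (gC (u, s u) (mem_ray _ _)).
Qed.

(** If g <= |.|_m norms R_m^** z, then f + R_m^* g is dominated by r + |R_m(.)|_m = p, so it lies in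
    the dual unit ball. *)
Lemma rest_add_hat_le1 (z : dual (dual V)) (f : dual V) : `|z| <= 1 ->
  (forall x, f x <= rest x) -> z f + s (hat z) <= 1.
Proof.
move=> z1 fr; have [g gs gz] := diag_norm_norming (hat z).
apply: le_trans (_ : z (f + adjoint g) <= 1).
  by rewrite op_morphD adjoint_hat lerD2l.
apply: (le_trans (dual_le _ z1)); apply: dual_norm_le1 => x.
by rewrite -[leRHS](subrK (s (A x))); apply: lerD; [exact: fr|exact: gs].
Qed.

(** On the graph of R_m in the product of V and l_1, the functional P (x, w) = r x + |w|_m equals p;
    extending h from the graph below P and restricting to the two factors gives f and g. *)
Lemma dual_ball_decomposition (h : dual V) : `|h| <= 1 ->
  exists (f : dual V) (g : dual (l1 R nat)),
  [/\ forall x, f x <= rest x, forall w, g w <= s w & h = f + adjoint g].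
Proof.
move=> h1.
pose P (c : V * l1 R nat) : R := rest c.1 + s c.2.
have sP : sublinear P.
  have [rD rZ] := rest_sublinear; have [sD sZ] := diag_norm_sublinear.
  split=> [x y|t x t0]; rewrite /P/=; first by rewrite addrACA lerD.
  by rewrite (rZ _ _ t0) (sZ _ _ t0) [RHS]mulrDr.
have AD x y : A (x + y) = A x + A y by exact: RmapD.
have AZ a x : A (a *: x) = a *: A x by exact: RmapZ.
have A0 : A 0 = 0 by rewrite -(scale0r 0) AZ scale0r.
pose C : set (V * l1 R nat * R) := [set c | exists x, c = ((x, A x), h x)].
have coneC : cone C.
  split=> [|_ _ [x ->] [y ->]|t _ t0 [x ->]].
  - by exists 0; rewrite A0 linear0.
  - by exists (x + y); rewrite AD op_morphD.
  - by exists (t *: x); rewrite AZ op_morphZ.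
have CP : below P C.
  by move=> _ [x ->]; rewrite /P/= /rest subrK; exact: dual_le.
have [F [lF FP FC]] := hahn_banach sP coneC CP.
have FD x y : F (x + y) = F x + F y by have := lF 1 x y; rewrite !scale1r.
have F0 : F 0 = 0 by have := FD 0 0; rewrite addr0; lra.
have FN x : F (- x) = - F x.
  by apply/eqP; rewrite -addr_eq0 -FD addNr F0.
have s0 : s 0 = 0 by exact: sublinear0 diag_norm_sublinear.
have r0 : rest 0 = 0 by exact: sublinear0 rest_sublinear.
have lf : linear (fun x : V => F (x, 0)).
  by move=> a x y; rewrite -lF; congr F; congr pair; rewrite /= scaler0 addr0.
have lg : linear (fun w : l1 R nat => F (0, w)).
  by move=> a x y; rewrite -lF; congr F; congr pair; rewrite /= scaler0 addr0.
have fr x : F (x, 0) <= rest x by apply: (le_trans (FP _)); rewrite /P/= s0 addr0.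
have gs w : F (0, w) <= s w by apply: (le_trans (FP _)); rewrite /P/= r0 add0r.
have fb x : `|F (x, 0)| <= 1 * `|x|.
  rewrite mul1r; apply: linear_le_norm lf _ (@normrN _ _) => y.
  by apply: (le_trans (fr y)); rewrite gerBl; exact: diag_norm_ge0.
have gb w : `|F (0, w)| <= 1 * `|w|.
  rewrite mul1r; apply: linear_le_norm lg _ (@normrN _ _) => y.
  by apply: (le_trans (gs y)); exact: diag_norm_le.
exists (Operator (bounded_linear_operator lf fb)).
exists (Operator (bounded_linear_operator lg gb)); split=> //.
apply/val_inj/funext => x.
have FA : F (x, A x) = F (x, 0) + F (0, A x).
  by rewrite -FD; congr F; congr pair; rewrite /= ?addr0 ?add0r.
apply: etrans FA.
apply/eqP; rewrite eq_le; apply/andP; split.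
  by apply: (FC (_, _)); exists x.
have : h (- x) <= F (- x, A (- x)) by apply: (FC (_, _)); exists (- x).
have -> : (- x, A (- x)) = - (x, A x) by congr pair; rewrite /= -scaleN1r AZ scaleN1r.
by rewrite FN linearN lerN2.
Qed.

Lemma hat_additive (x y : dual (dual V)) : `|x| <= 1 -> `|y| <= 1 ->
  2 <= `|x + y| -> s (hat x) + s (hat y) <= s (hat x + hat y).
Proof.
move=> x1 y1; rewrite leNgt => xy; rewrite leNgt; apply: contra xy => lt.
(* [B] adds up x f <= 1 - s (hat x), y f <= 1 - s (hat y) and g <= s at hat x + hat y; it is less
   than 2 if additivity fails. *)
pose B := 2 - (s (hat x) + s (hat y)) + s (hat x + hat y).
apply: (@le_lt_trans _ _ B); last by rewrite /B; lra.
have up (h : dual V) : `|h| <= 1 -> (x + y) h <= B.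
  move=> h1; have [f [g [fr gs ->]]] := dual_ball_decomposition h1.
  have -> : (x + y) (f + adjoint g) = x f + y f + g (hat x + hat y).
    by rewrite op_morphD adjoint_hat hatD.
  have := rest_add_hat_le1 x1 fr; have := rest_add_hat_le1 y1 fr.
  have := gs (hat x + hat y); rewrite /B; lra.
apply: opnorm_le => h h1; rewrite ler_norml up// andbT lerNl -linearN.
by apply: up; rewrite normrN.
Qed.

Lemma diag_norm_hat_le1 (z : dual (dual V)) : `|z| <= 1 -> s (hat z) <= 1.
Proof.
move=> z1; have := @rest_add_hat_le1 z 0 z1 rest_ge0.
by rewrite linear0 add0r.
Qed.

End fixed_index.
End bidual.

Arguments hat {R N} T m z.
Arguments restrict {R N} T z.

(** * Strict convexity of the bidual *)

Section bidual_strict_convexity.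
Variables (R : realType) (N : equiv_norm (c0 R)).
Variable T : operator (l1 R (nat * nat)%type) (dual (renorm N)).

Lemma hat_sign (m n : nat) (x y : dual (dual (frakX T))) :
  let w := `|vstar T n m|^-1 *: vstar T n m in
  `|x| <= 1 -> `|y| <= 1 -> 2 <= `|x + y| ->
  1 < m.+1%:R * restrict T x w -> ~ m.+1%:R * restrict T y w < - 1.
Proof.
move=> w x1 y1 xy xw yw.
(* If v_{n,m} were 0, then w would be 0 as well, against [xw]. *)
have v0 : 0 < `|vstar T n m|.
  rewrite normr_gt0; apply: contraTneq xw => v0.
  by rewrite /w v0 scaler0 linear0 mulr0 ltr10.
have Phi0 : 0 < Phi T m n by rewrite !mulr_gt0// exprn_gt0// invr_gt0.
(* [Phi] contains the factor |v_{n,m}| that w divides out. *)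
have hat_w z : hat T m z n = Phi T m n * (m.+1%:R * restrict T z w).
  have -> : restrict T z w = `|vstar T n m|^-1 * restrict T z (vstar T n m).
    exact: op_morphZ.
  rewrite hatE /Phi -[RHS]mulrA [ `|_| * _]mulrCA mulVKf ?gt_eqF//; ring.
have s_gt0 z : m.+1%:R * restrict T z w != 0 -> 0 < diag_norm T m (hat T m z).
  move=> zw; rewrite lt0r diag_norm_ge0 andbT; apply: contra zw => /eqP.
  rewrite diag_equiv_normE => /enorm_eq0 z0.
  have /esym/eqP := hat_w z; rewrite z0 [X in _ == X]/(0 : R).
  by rewrite mulf_eq0 (gt_eqF Phi0).
have sx0 := s_gt0 x (lt0r_neq0 (lt_trans ltr01 xw)).
have sy0 : 0 < diag_norm T m (hat T m y).
  by apply: s_gt0; rewrite lt_eqF// (lt_trans yw)// ltrN10.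
have [b [b' [a [a' [bb' a1 a'1 xE yE]]]]] :=
  diag_norm_additive_sign sx0 sy0 (@hat_additive R N T m x y x1 y1 xy).
(* With b n <= 0 the n-th coordinate would be at most Phi_m(n), since |R_m^** x|_m <= 1 and |a n| <=
   1, against [xw]. *)
have b0 : 0 < b n.
  rewrite ltNge; apply/negP => bn; move: (xE n).
  rewrite hat_w => E.
  have sa : diag_norm T m (hat T m x) * a n <= 1.
    apply: (le_trans (ler_norm _)); rewrite normrM mulr_ile1//.
    by rewrite ger0_norm ?diag_norm_hat_le1// ltW.
  have : Phi T m n * 1 < Phi T m n * (m.+1%:R * restrict T x w) by rewrite ltr_pM2l.
  rewrite E; have : Phi T m n * (diag_norm T m (hat T m x) * a n) <= Phi T m n * 1.
    by rewrite ler_pM2l.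
  have : diag_norm T m (hat T m x) * b n <= 0 by rewrite mulr_ge0_le0// ltW.
  lra.
(* By [bb'] it suffices to show b' n < 0; the mirrored estimate does this. *)
have := bb' n; rewrite pmulr_rge0// leNgt => /negP; apply.
rewrite ltNge; apply/negP => bn; move: (yE n).
rewrite hat_w => E.
have sa : - 1 <= diag_norm T m (hat T m y) * a' n.
  rewrite lerNl; apply: (le_trans (ler_norm _)).
  rewrite normrN normrM mulr_ile1//.
  by rewrite ger0_norm ?diag_norm_hat_le1// ltW.
have : Phi T m n * (m.+1%:R * restrict T y w) < Phi T m n * - 1 by rewrite ltr_pM2l.
rewrite E; have : Phi T m n * - 1 <= Phi T m n * (diag_norm T m (hat T m y) * a' n).
  by rewrite ler_pM2l.
have : 0 <= diag_norm T m (hat T m y) * b' n by rewrite mulr_ge0// ltW.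
lra.
Qed.

Variable Y : set (dual (renorm N)).
Hypotheses (Y_range : operator_range Y) (Y_dense : dense Y).
Hypothesis T_dense : forall m : nat,
  unit_sphere Y `<=`
  closure [set `|vstar T n m|^-1 *: vstar T n m | n in [set: nat]].

Lemma open_functional_gt (V : normedModType R) (z : dual V) (c : R) :
  open [set f | c < z f].
Proof.
apply: (@open_comp _ R z [set r | c < r]) => [f _|]; last exact: open_gt.
exact: op_continuous.
Qed.

Lemma open_functional_lt (V : normedModType R) (z : dual V) (c : R) :
  open [set f | z f < c].
Proof.
apply: (@open_comp _ R z [set r | r < c]) => [f _|]; last exact: open_lt.
exact: op_continuous.
Qed.

(** A violation x f > 0 > y f persists near f, hence occurs at a point of S_Y, and then at a
    normalized v_{n,m} with m so large that [hat_sign] applies. *)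
Lemma bidual_sign (x y : dual (dual (frakX T))) (f : dual (frakX T)) :
  `|x| <= 1 -> `|y| <= 1 -> 2 <= `|x + y| -> 0 < x f -> 0 <= y f.
Proof.
move=> x1 y1 xy; have [f0 <-] := dual_incl_surj f => xf.
rewrite leNgt; apply/negP => yf.
have [g [[xg yg] Yg]] : [set g | 0 < restrict T x g] `&` [set g | restrict T y g < 0]
    `&` Y !=set0.
  apply: Y_dense; first by exists f0.
  by apply: openI; [exact: open_functional_gt|exact: open_functional_lt].
have {}xg : 0 < restrict T x g := xg.
have {}yg : restrict T y g < 0 := yg.
have g0 : 0 < `|g|.
  by rewrite normr_gt0; apply: contraTneq xg => ->; rewrite op_morph0 ltxx.
pose e := `|g|^-1 *: g.
have xe : 0 < restrict T x e by rewrite op_morphZ mulr_gt0// invr_gt0.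
have ye : restrict T y e < 0 by rewrite op_morphZ pmulr_rlt0// invr_gt0.
have Ye : unit_sphere Y e.
  split; last by rewrite normrZ gtr0_norm ?invr_gt0// mulVf// gt_eqF.
  have [E [S [_ _ SY]]] := Y_range.
  move: Yg; rewrite -SY => -[u _ ug]; exists (`|g|^-1 *: u) => //.
  by rewrite op_morphZ ug.
have [m [mx my]] : exists m, 1 < m.+1%:R * restrict T x e /\
    m.+1%:R * restrict T y e < - 1.
  (* Any [m.+1] above 1 / d scales both values beyond 1 in modulus. *)
  pose d := Num.min (restrict T x e) (- restrict T y e).
  have d0 : 0 < d by rewrite lt_min xe oppr_gt0.
  have md : 1 < (Num.truncn d^-1).+1%:R * d.
    by rewrite -ltr_pdivrMr// mul1r truncnS_gt.
  exists (Num.truncn d^-1); split.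
    by apply: (lt_le_trans md); rewrite ler_wpM2l// ge_min lexx.
  rewrite ltrNr -mulrN; apply: (lt_le_trans md).
  by rewrite ler_wpM2l// ge_min lexx orbT.
pose xm : dual (dual (renorm N)) := m.+1%:R *: restrict T x.
pose ym : dual (dual (renorm N)) := m.+1%:R *: restrict T y.
(* Density holds for each m separately, so the m just chosen can be kept while n varies. *)
have [|_ [[n _ <-] [xw yw]]] :=
    @T_dense m e Ye ([set h | 1 < xm h] `&` [set h | ym h < - 1]).
  apply: open_nbhs_nbhs; split=> //.
  by apply: openI; [exact: open_functional_gt|exact: open_functional_lt].
exact: (@hat_sign m n x y).
Qed.

Lemma frakX_bidual_strictly_convex : strictly_convex (dual (dual (frakX T))).
Proof.
move=> x y x1 y1 xney; rewrite ltNge; apply/negP => xy.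
apply: xney.
have sign f : 0 < x f -> 0 <= y f.
  by apply: bidual_sign; rewrite ?x1 ?y1.
have [f xf] : exists f, x f = 1.
  have [g xg] : exists g, x g != 0.
    apply: contrapT => /forallNP x0; move/eqP: x1; apply/negP.
    suff -> : x = 0 by rewrite normr0 eq_sym oner_eq0.
    by apply/val_inj/funext => g; apply/eqP; apply/negPn/negP => /x0.
  by exists ((x g)^-1 *: g); rewrite op_morphZ [LHS]mulVf.
have ker g : x g = 0 -> y g = 0.
  move=> xg; apply/eqP/negPn/negP => yg.
  (* This element has x-value 1 and y-value - 1, against [sign]. *)
  have := sign (f - ((y f + 1) / y g) *: g).
  rewrite !op_morphB !op_morphZ xf xg scaler0 subr0 => /(_ ltr01).
  by rewrite [_ *: _]divfK// opprD addrA subrr sub0r lerNr oppr0 ler10.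
have yE g : y g = y f * x g.
  have /ker : x (g - x g *: f) = 0 by rewrite op_morphB op_morphZ xf [_ *: _]mulr1 subrr.
  by rewrite op_morphB op_morphZ => /eqP; rewrite subr_eq0 => /eqP ->; rewrite mulrC.
have yxE : y = y f *: x by apply/val_inj/funext => g; exact: yE.
have yf0 : 0 <= y f by apply: sign; rewrite xf.
rewrite yxE; move: y1; rewrite {1}yxE normrZ x1 mulr1 ger0_norm// => ->.
by rewrite scale1r.
Qed.

End bidual_strict_convexity.

Theorem proposition3 (R : realType) (N : equiv_norm (c0 R))
  (N_smooth : smooth (renorm N))
  (N_NA : [set (f : c0 R -> R) | f in NA (renorm N)] =
          [set (f : c0 R -> R) | f in NA (c0 R)])
  (Y : set (dual (renorm N)))
  (Y_range : operator_range Y)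
  (Y_separable : separable Y)
  (Y_dense : dense Y)
  (Y_NA : NA (renorm N) `&` Y = [set 0])
  (T : operator (l1 R (nat * nat)%type) (dual (renorm N)))
  (T_Y : range T `<=` Y)
  (T_norm : `|T| = 1)
  (T_inj : injective T)
  (T_dense : forall m : nat,
     unit_sphere Y `<=`
     closure [set `|vstar T n m|^-1 *: vstar T n m | n in [set: nat]]) :
  strictly_convex (dual (dual (frakX T))) /\ smooth (dual (frakX T)).
Proof.
have sc := frakX_bidual_strictly_convex Y_range Y_dense T_dense.
by split=> //; exact: strictly_convex_dual_smooth.
Qed.
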